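(* Let $\phi:\mathbb{C}\to\mathbb{R}$ be a $C^4$-smooth function with $\Delta\phi>0$ everywhere on $\mathbb{C}$, satisfying the curvature-type condition $$\frac{1}{\Delta\phi}\,\Delta\log\Delta\phi\ge-2\qquad\text{on }\mathbb{C}.$$ Suppose $f\in L^2(\mathbb{C},\mathrm{e}^{2\phi})$ satisfies $$\int_{\mathbb{C}} f g\,\mathrm{d}A=0\qquad\text{for all } g\in A^2(\mathbb{C},\mathrm{e}^{-2\phi}).$$ Then the solution $u$ to $\bar\partial u=f$ on $\mathbb{C}$ with $$\int_{\mathbb{C}}|u|^2\,\mathrm{e}^{2\phi}\,\Delta\phi\,\mathrm{d}A\le\frac12\int_{\mathbb{C}}|f|^2\,\mathrm{e}^{2\phi}\,\mathrm{d}A$$ is unique; that is, any two functions $u$ satisfying both this equation and this estimate coincide (almost everywhere).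
   Context: Write $z=x+\mathrm{i}y\in\mathbb{C}$. $\mathrm{d}A(z)=\mathrm{d}x\,\mathrm{d}y$ is area measure. $\Delta=\frac14\left(\frac{\partial^2}{\partial x^2}+\frac{\partial^2}{\partial y^2}\right)$ is the normalized Laplacian (note the factor $\frac14$), and $\bar\partial=\frac12\left(\frac{\partial}{\partial x}+\mathrm{i}\frac{\partial}{\partial y}\right)$. For a positive weight $\omega$ on $\mathbb{C}$, $L^2(\mathbb{C},\omega)$ is the space of (complex-valued, measurable, modulo a.e. equality) functions $g$ on $\mathbb{C}$ with $\int_{\mathbb{C}}|g|^2\omega\,\mathrm{d}A<+\infty$. $A^2(\mathbb{C},\mathrm{e}^{-2\phi})$ is the space of entire functions belonging to $L^2(\mathbb{C},\mathrm{e}^{-2\phi})$. The equation $\bar\partial u=f$ is understood in the sense of distributions on $\mathbb{C}$. *)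

(* Defs.v *)
From HB Require Import structures.
From mathcomp Require Import all_boot all_order all_algebra.
From mathcomp Require Import complex.
From mathcomp Require Import all_classical all_reals all_analysis.

Set Implicit Arguments.
Unset Strict Implicit.
Unset Printing Implicit Defensive.

Import Order.TTheory GRing.Theory Num.Theory.
Import numFieldNormedType.Exports.

Local Open Scope classical_set_scope.
Local Open Scope ring_scope.

(* R[i] seen as a numFieldType, so that the topology and the normed-module
   structure over itself of a numFieldType are found by inference; a derivative
   of a function Cplx R -> Cplx R is thus a complex derivative. *)
Definition Cplx (R : realType) : numFieldType := R[i]%C.

Section Plane.
Context {R : realType}.
Local Notation C := (Cplx R).
Implicit Types (z : C) (h : C -> R) (g u f psi : C -> C).

Definition toC (p : R * R) : C := (p.1 +i* p.2)%C.
Definition re z : R := complex.Re z.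
Definition im z : R := complex.Im z.
Definition modulus z : R := ComplexField.Normc.normc z.

Definition slice_x h z : R -> R := fun x => h (toC (x, im z)).
Definition slice_y h z : R -> R := fun y => h (toC (re z, y)).

Definition dx h : C -> R := fun z => derive1 (slice_x h z) (re z).
Definition dy h : C -> R := fun z => derive1 (slice_y h z) (im z).

Fixpoint Ck (n : nat) h : Prop :=
  continuous h /\
  if n is m.+1 then
    [/\ forall z, derivable (slice_x h z) (re z) 1,
        forall z, derivable (slice_y h z) (im z) 1,
        Ck m (dx h) & Ck m (dy h)]
  else True.

(* The Laplacian is normalized by the factor 1/4. *)
Definition lap h : C -> R := fun z => 4^-1 * (dx (dx h) z + dy (dy h) z).

Definition dxC psi : C -> C :=
  fun z => toC (dx (re \o psi) z, dx (im \o psi) z).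
Definition dyC psi : C -> C :=
  fun z => toC (dy (re \o psi) z, dy (im \o psi) z).

Definition dbar psi : C -> C :=
  fun z => 2^-1 * (dxC psi z + toC (0, 1) * dyC psi z).

Definition entire g : Prop := forall z, derivable g z 1.

(* The area measure lives on R * R; functions on C are pulled back by toC. *)

Local Notation plane := (measurableTypeR R * measurableTypeR R)%type.

Definition area : {measure set plane -> \bar R} :=
  (@lebesgue_measure R \x @lebesgue_measure R)%E.

Definition measurable_cfun g : Prop :=
  measurable_fun setT (fun p : plane => re (g (toC p))) /\
  measurable_fun setT (fun p : plane => im (g (toC p))).

Definition ae_eqC u1 u2 : Prop := {ae area, forall p, u1 (toC p) = u2 (toC p)}.

(* Only meaningful when F is integrable. *)
Definition integralC (F : C -> C) : C :=
  toC (\int[area]_p re (F (toC p)), \int[area]_p im (F (toC p))).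

Definition sqnorm (w : C -> R) g : \bar R :=
  (\int[area]_p (modulus (g (toC p)) ^+ 2 * w (toC p))%:E)%E.

(* Representatives of the elements of L^2(C, w). *)
Definition L2 (w : C -> R) g : Prop := measurable_cfun g /\ (sqnorm w g < +oo)%E.

Definition A2 (w : C -> R) g : Prop := entire g /\ L2 w g.

Definition L1loc g : Prop := measurable_cfun g /\
  forall K : set C, compact K ->
    (\int[area]_(p in toC @^-1` K) (modulus (g (toC p)))%:E < +oo)%E.

Definition test_function psi : Prop :=
  [/\ forall n, Ck n (re \o psi), forall n, Ck n (im \o psi)
    & compact (closure [set z | psi z != 0])].

(* u and f are required to be locally integrable so that they define
   distributions and both integrals below converge. *)
Definition dbar_distr u f : Prop :=
  [/\ L1loc u, L1loc f & forall psi, test_function psi ->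
    integralC (fun z => u z * dbar psi z) = - integralC (fun z => f z * psi z)].

End Plane.

(* Main.v *)
(* The difference v = u1 - u2 satisfies dbar v = 0 weakly and |v|^2 e^psi is
   integrable, where e^psi = e^(2 phi) Delta phi; the curvature condition says
   that psi is subharmonic. For a holomorphic h the function S = |h|^2 e^psi is
   then subharmonic, and integrating Delta S against (L - |z|^2)_+^3 bounds the
   mass of S on |z|^2 <= L / 6 by its mass on |z|^2 >= L / 3, which tends to 0
   with 1 / L when S is integrable. No regularity theorem for v is needed: the
   estimate is applied to the holomorphic mollifications of v, whose squares are
   controlled by Jensen's inequality through the mollification of |v|^2. Letting
   the mollification parameter tend to 0, and then L to infinity, shows that v
   has integral 0 on every rectangle, hence vanishes almost everywhere. *)

(* The cutoff estimate is uniform in L for the following reason. Up to the factor 12, the Laplacian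
   of (L - |z|^2)^3 is (L - |z|^2) (3 |z|^2 - L), which inside the disc changes sign only at |z|^2 =
   L / 3. Its negative part is at least L^2 / 3 on |z|^2 <= L / 6 and its positive part is at most 2
   L^2, so the inner mass is at most 6 times a tail of a convergent integral. The order of the two
   limits is dictated by the weight: e^psi does not commute with mollification, and nothing is known
   about its growth. With L fixed, everything happens on a compact set, where e^psi lies between two
   positive constants; the mollification parameter tends to 0 there, and only then does L grow.
   Mollifications converge here only when integrated against a fixed function, so both sides of the
   estimate are made linear first: the outer one becomes linear in |v|^2 through Jensen, the inner
   one linear in the real or imaginary part g of v through g^2 >= 2 t g - t^2, with t optimized at
   the very end. *)
From HB Require Import structures.
Require Import Defs.
From mathcomp Require Import all_boot all_order all_algebra.
From mathcomp Require Import complex.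
From mathcomp Require Import all_classical all_reals all_analysis.
From mathcomp Require Import measurable_realfun.
From mathcomp Require Import ring lra.
Set Implicit Arguments.
Unset Strict Implicit.
Unset Printing Implicit Defensive.
Import Order.TTheory GRing.Theory Num.Theory.
Import numFieldNormedType.Exports.
Local Open Scope classical_set_scope.
Local Open Scope ring_scope.

(** * The plane as a measurable and topological space *)

Section plane_topology.
Context {R : realType}.
Local Notation C := (Cplx R).
Local Notation plane := (measurableTypeR R * measurableTypeR R)%type.

(** The boxes with rational corners form a countable base. This links the product topology to the
    product sigma-algebra, which are separate structures on the plane. *)
Lemma open_plane_measurable (U : set (R * R)) :
  open U -> measurable (U : set plane).
Proof.
move=> oU.
pose box (q : rat * rat * (rat * rat)) : set plane :=
  `]ratr q.1.1 : R, ratr q.1.2 : R[ `*` `]ratr q.2.1 : R, ratr q.2.2 : R[.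
rewrite (_ : (U : set plane) =
    \bigcup_q (if `[< box q `<=` U >] then box q else set0)); last first.
  apply/seteqP; split=> [[x y] Uxy|p [q _]]; last first.
    by case: asboolP => // qU /qU.
  have /nbhs_ballP[e /= e0 eU] : nbhs (x, y) U by exact: open_nbhs_nbhs.
  have itv (z : R) : exists q : rat * rat, [/\ (ratr q.1 : R) < z,
      z < ratr q.2 & forall w, (ratr q.1 : R) < w < ratr q.2 -> ball z e w].
    have [q /[!in_itv]/= /andP[q1 q2]] : exists q : rat, ratr q \in `]z - e, z[.
      by apply: rat_in_itvoo; rewrite ltrBlDr ltrDl.
    have [r /[!in_itv]/= /andP[r1 r2]] : exists q : rat, ratr q \in `]z, z + e[.
      by apply: rat_in_itvoo; rewrite ltrDl.
    exists (q, r); split=> // w /= /andP[qw wr].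
    by rewrite /ball /= ltr_norml; apply/andP; split; lra.
  have [q [q1 q2 qb]] := itv x; have [r [r1 r2 rb]] := itv y.
  exists (q, r) => //; case: asboolP => [_|]; last first.
    case; move=> [a b] [] /=; rewrite !in_itv/= => /qb qa /rb ra.
    by apply: eU; split.
  by split; rewrite /= in_itv /= ?q1 ?q2 ?r1 ?r2.
apply: countable_bigcupT_measurable => // q.
case: asboolP => // _; apply: measurableX; exact: measurable_itv.
Qed.

Lemma continuous_plane_measurable (F : R * R -> R) :
  continuous F -> measurable_fun setT (F : plane -> R).
Proof.
move=> /continuousP cF; apply: (measurability _ (RGenOpens.measurableE R)).
move=> _ [_ [a [b ->] <-]]; rewrite setTI.
by apply: open_plane_measurable; apply: cF; apply: interval_open.
Qed.

Lemma re_toC (p : R * R) : re (toC p) = p.1. Proof. by []. Qed.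
Lemma im_toC (p : R * R) : im (toC p) = p.2. Proof. by []. Qed.

Lemma toC_re_im (z : C) : toC (re z, im z) = z.
Proof. by case: z. Qed.

Lemma normc_bounds (z : C) :
  [/\ `|re z| <= modulus z, `|im z| <= modulus z
    & modulus z <= `|re z| + `|im z|].
Proof.
case: z => a b; rewrite /modulus /re /im /=.
split.
- by rewrite -sqrtr_sqr ler_wsqrtr// lerDl sqr_ge0.
- by rewrite -sqrtr_sqr ler_wsqrtr// lerDr sqr_ge0.
- rewrite -[leRHS]ger0_norm ?addr_ge0// -sqrtr_sqr ler_wsqrtr//.
  rewrite sqrrD !real_normK ?num_real// -addrA lerD2l lerDr.
  by rewrite mulrn_wge0// mulr_ge0.
Qed.

Lemma sqr_modulus (z : C) : modulus z ^+ 2 = re z ^+ 2 + im z ^+ 2.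
Proof. by case: z => a b; rewrite /modulus /= sqr_sqrtr// addr_ge0// sqr_ge0. Qed.

Lemma ball_Cplx (z w : C) (e : R) :
  ball z (e%:C)%C w <-> modulus (z - w) < e.
Proof. by rewrite /ball /= ltcR. Qed.

Lemma continuous_toC : continuous (@toC R).
Proof.
move=> p; apply/cvgrPdist_lt => /= e e0.
(* The norm of [Cplx R] is itself complex-valued, so [e] is a complex number; [0 < e] forces its
   imaginary part to vanish. *)
have [d d0 ed] : exists2 d : R, 0 < d & e = (d%:C)%C.
  move: e0; case: e => a b; rewrite ltcE/= => /andP[/eqP -> a0].
  by exists a.
near=> q; rewrite ed; apply/ball_Cplx.
have [_ _ h] := normc_bounds (toC p - toC q).
apply: (le_lt_trans h); rewrite (splitr d) ltrD//.
- near: q; move: p => [p1 p2] /=; exists (ball p1 (d / 2), setT) => /=.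
    by split; [by apply: nbhsx_ballx; rewrite divr_gt0|exact: filterT].
  by move=> [a b] [].
- near: q; move: p => [p1 p2] /=; exists (setT, ball p2 (d / 2)) => /=.
    by split; [exact: filterT|by apply: nbhsx_ballx; rewrite divr_gt0].
  by move=> [a b] [].
Unshelve. all: by end_near. Qed.

Lemma continuous_re : continuous (@re R).
Proof.
move=> z A /nbhs_ballP[e /= e0 eA]; apply/nbhs_ballP.
exists (e%:C)%C => /=; first by rewrite ltcR.
move=> w /ball_Cplx zw; apply: eA; apply: le_lt_trans zw.
by have [+ _ _] := normc_bounds (z - w); case: z w => [a b] [c d].
Qed.

Lemma continuous_im : continuous (@im R).
Proof.
move=> z A /nbhs_ballP[e /= e0 eA]; apply/nbhs_ballP.
exists (e%:C)%C => /=; first by rewrite ltcR.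
move=> w /ball_Cplx zw; apply: eA; apply: le_lt_trans zw.
by have [_ + _] := normc_bounds (z - w); case: z w => [a b] [c d].
Qed.

Definition box (M : R) : set (R * R) := `[- M, M] `*` `[- M, M].

Lemma boxP (M : R) (p : R * R) : box M p <-> `|p.1| <= M /\ `|p.2| <= M.
Proof. by rewrite /box /= !in_itv/= !ler_norml. Qed.

Lemma measurable_box (M : R) : measurable (box M : set plane).
Proof. by apply: measurableX; exact: measurable_itv. Qed.

Lemma compact_box (M : R) : compact (box M).
Proof. by apply: compact_setX; exact: segment_compact. Qed.

(** The copy of [box] in the complex plane, where [L1loc] and [test_function] look for compact
    sets. *)
Definition Cbox (M : R) : set C := [set z | `|re z| <= M /\ `|im z| <= M].

Lemma preimage_Cbox (M : R) : toC @^-1` Cbox M = box M.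
Proof. by apply/seteqP; split => p /=; rewrite boxP. Qed.

Lemma compact_Cbox (M : R) : compact (Cbox M).
Proof.
rewrite (_ : Cbox M = (@toC R) @` box M).
  apply: continuous_compact; last exact: compact_box.
  by apply: continuous_subspaceT => p; exact: continuous_toC.
apply/seteqP; split => [z [z1 z2]|_ [p /boxP pM <-] //].
by exists (re z, im z); [apply/boxP|exact: toC_re_im].
Qed.

Lemma continuous_box_bounded (F : R * R -> R) (M : R) :
  continuous F -> exists2 K : R, 0 < K & forall p, box M p -> `|F p| <= K.
Proof.
move=> cF.
have /compact_bounded[K [_ hK]] : compact (F @` box M).
  apply: continuous_compact; last exact: compact_box.
  by apply: continuous_subspaceT => p; exact: cF.
exists (`|K| + 1); first by rewrite ltr_wpDl.
move=> p pM; apply: hK; last by exists p.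
by rewrite ltr_pwDr// ler_norm.
Qed.

End plane_topology.

(** * Derivatives and smooth bump functions on the line *)

Section real_derivatives.
Context {R : realType}.
Implicit Types (f g : R -> R) (x a b : R).

Local Notation is_der x f a := (is_derive (x : R) (1 : R) (f : R -> R) (a : R)).

Lemma derD f g x a b : is_der x f a -> is_der x g b ->
  is_der x (fun t => f t + g t) (a + b).
Proof. by move=> fa gb; exact: is_deriveD. Qed.

Lemma derB f g x a b : is_der x f a -> is_der x g b ->
  is_der x (fun t => f t - g t) (a - b).
Proof. by move=> fa gb; exact: is_deriveB. Qed.

Lemma derM f g x a b : is_der x f a -> is_der x g b ->
  is_der x (fun t => f t * g t) (a * g x + f x * b).
Proof.
move=> fa gb; have h := is_deriveM fa gb; apply: (is_derive_eq h).
by rewrite addrC /GRing.scale/= (mulrC (g x)).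
Qed.

Lemma derN f x a : is_der x f a -> is_der x (fun t => - f t) (- a).
Proof. by move=> fa; exact: is_deriveN. Qed.

Lemma derC k x : is_der x (fun=> k) 0.
Proof. exact: is_derive_cst. Qed.

Lemma derZ k f x a : is_der x f a -> is_der x (fun t => k * f t) (k * a).
Proof. by move=> fa; exact: is_deriveZ. Qed.

Lemma der_id x : is_der x id 1.
Proof. exact: is_derive_id. Qed.

Lemma derX n f x a : is_der x f a ->
  is_der x (fun t => f t ^+ n) (n%:R * f x ^+ n.-1 * a).
Proof. move=> fa; have h := @is_deriveX _ _ f n x 1 a fa.
by rewrite exprfctE in h. Qed.

Lemma der_comp f g x a b : is_der x g b -> is_der (g x) f a ->
  is_der x (fun t => f (g t)) (a * b).
Proof. by move=> gb fa; exact: is_derive1_comp. Qed.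

Lemma der_expR f x a : is_der x f a ->
  is_der x (fun t => expR (f t)) (expR (f x) * a).
Proof. by move=> fa; apply: der_comp => //; exact: is_derive_expR. Qed.

Lemma derV f x a : is_der x f a -> f x != 0 ->
  is_der x (fun t => (f t)^-1) (- (f x ^- 2) * a).
Proof. by move=> fa f0; exact: is_deriveV. Qed.

Lemma der_ln f x a : is_der x f a -> 0 < f x ->
  is_der x (fun t => ln (f t)) (a / f x).
Proof.
by move=> fa f0; rewrite mulrC; apply: der_comp => //; exact: is_derive1_ln.
Qed.

Lemma der_horner (P : {poly R}) x : is_der x (fun y => P.[y]) P^`().[x].
Proof. exact: is_derive_poly. Qed.

Lemma der_near f g x a : (\forall y \near x, f y = g y) ->
  is_der x f a -> is_der x g a.
Proof. by move=> fg; apply: near_eq_is_derive. Qed.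

Lemma der_continuous f x a : is_der x f a -> {for x, continuous f}.
Proof.
move=> fa; apply/differentiable_continuous/derivable1_diffP.
exact: (@ex_derive _ _ _ _ _ _ a).
Qed.

Lemma der_derivable f x a : is_der x f a -> derivable f x 1.
Proof. by move=> fa; exact: (@ex_derive _ _ _ _ _ _ a). Qed.

Lemma der_derive1 f x a : is_der x f a -> f^`()%classic x = a.
Proof. by move=> fa; rewrite derive1E derive_val. Qed.

Lemma derivable_der f x : derivable f x 1 -> is_der x f (f^`()%classic x).
Proof. by move=> df; rewrite derive1E; exact: derivableP. Qed.

(** A quadratic remainder is stronger than differentiability but is stable under integration and
    easy to check across a gluing point. It serves for the ends of the bump, for the powers of a
    positive part and for convolutions. *)
Lemma der_quadratic f x a (K : R) :
  (forall y, `|y - x| <= 1 ->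
    `|f y - f x - a * (y - x)| <= K * (y - x) ^+ 2) -> is_der x f a.
Proof.
move=> fK.
have H : h^-1 *: (f (h + x) - f x) @[h --> 0^'] --> a.
  apply/cvgrPdist_le => e e0.
  have K0 : 0 < `|K| + 1 by rewrite ltr_wpDl.
  near=> h.
  have h0 : h != 0 by near: h; exact: nbhs_dnbhs_neq.
  have he : `|h| <= e / (`|K| + 1).
    near: h; apply: dnbhs0_le; exact: divr_gt0.
  have h1 : `|h| <= 1 by near: h; exact: dnbhs0_le.
  have := fK (h + x); rewrite addrK => /(_ h1) hK.
  rewrite -[leLHS](mulfK (_ : `|h| != 0)) ?normr_eq0//.
  rewrite ler_pdivrMr ?normr_gt0// -normrM mulrBl /GRing.scale/= mulrAC mulVf//.
  rewrite mul1r distrC (le_trans hK)//.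
  rewrite -(real_normK (num_real h)) expr2 mulrA ler_wpM2r//.
  rewrite (@le_trans _ _ ((`|K| + 1) * `|h|))//.
    by rewrite ler_wpM2r// (le_trans (ler_norm K))// lerDl.
  by rewrite mulrC -ler_pdivlMr.
have E : (fun h : R => h^-1 *: (f (h *: (1 : R) + x) - f x)) =
    (fun h => h^-1 *: (f (h + x) - f x)).
  by apply/funext => h; rewrite [h *: _]mulr1.
apply: DeriveDef.
  by apply/cvg_ex; exists a; rewrite E.
by rewrite /derive E; exact: cvg_lim.
Unshelve. all: by end_near. Qed.

(** With y = 1 / q, exp y = exp (y / n)^n >= (y / n)^n, whence the constant n^n. *)
Lemma bump_quotient_bound (n : nat) : exists2 K : R, 0 <= K &
  forall q, 0 < q -> q ^- n * expR (- q^-1) <= K.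
Proof.
exists (n%:R ^+ n); first by rewrite exprn_ge0.
move=> q q0; case: n => [|n].
  by rewrite !expr0 invr1 mul1r -[leRHS]expR0 ler_expR oppr_le0 invr_ge0 ltW.
rewrite expRN ler_pdivrMr ?expR_gt0//.
have n0 : (0 : R) < n.+1%:R by [].
rewrite -[q^-1](mulVKf (lt0r_neq0 n0)) expRM_natl -exprMn -exprVn.
rewrite lerXn2r ?nnegrE ?mulr_ge0 ?expR_ge0 ?invr_ge0 ?(ltW q0)//.
rewrite -[X in X <= _](mulVKf (lt0r_neq0 n0)) ler_wpM2l//.
by apply: le_trans (expR_ge1Dx _); rewrite lerDr.
Qed.

Definition bumpQ : {poly R} := 'X * (1 - 'X).

Lemma bumpQE x : bumpQ.[x] = x * (1 - x).
Proof. by rewrite /bumpQ !hornerE. Qed.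

(* The functions P / Q^k exp (- 1 / Q) with Q = x (1 - x), extended by zero
   outside ]0, 1[, are stable under differentiation. *)
Definition bump (P : {poly R}) (k : nat) x : R :=
  if 0 < x < 1 then P.[x] * (bumpQ.[x] ^- k * expR (- bumpQ.[x]^-1)) else 0.

(** The numerator of the derivative over the denominator Q^(k + 2): the exponential contributes Q' /
    Q^2, which raises the order of the pole by two. *)
Definition bumpD (P : {poly R}) (k : nat) : {poly R} :=
  P^`() * bumpQ ^+ 2 - k%:R *: (P * bumpQ^`() * bumpQ) + P * bumpQ^`().

Lemma horner_bumpD P k x : (bumpD P k).[x] = P^`().[x] * bumpQ.[x] ^+ 2
  - k%:R * (P.[x] * bumpQ^`().[x] * bumpQ.[x]) + P.[x] * bumpQ^`().[x].
Proof. by rewrite /bumpD; move: bumpQ => Q; rewrite !hornerE. Qed.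

Lemma der_bump P k x : is_der x (bump P k) (bump (bumpD P k) k.+2 x).
Proof.
have Q0 y : 0 < y < 1 -> 0 < bumpQ.[y].
  by move=> /andP[y0 y1]; rewrite bumpQE mulr_gt0// subr_gt0.
have [x01|x01] := boolP (0 < x < 1).
  have Qx := Q0 _ x01; have Qn0 := lt0r_neq0 Qx.
  apply: (@der_near (fun y => P.[y] * ((bumpQ.[y] ^+ k)^-1 *
      expR (- bumpQ.[y]^-1)))).
    near=> y; rewrite /bump ifT//; near: y.
    have : x \in `]0, 1[ by rewrite in_itv.
    by move/near_in_itvoo; apply: filterS => y; rewrite in_itv.
  have dQ := der_horner bumpQ x.
  have Qk0 : bumpQ.[x] ^+ k != 0 by rewrite expf_neq0.
  apply: (is_derive_eq (derM (der_horner P x)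
    (derM (derV (derX k dQ) Qk0) (der_expR (derN (derV dQ Qn0)))))).
  rewrite /bump x01 horner_bumpD.
  move: Qn0 {dQ Qk0}; set q := bumpQ.[x]; set q' := bumpQ^`().[x].
  set E := expR _; rewrite /GRing.scale/= => q0.
  case: k => [|k]; first by rewrite !expr0; field.
  rewrite /= !exprS; have : q ^+ k != 0 by rewrite expf_neq0.
  by set qk := q ^+ k => qk0; field; rewrite qk0.
have fx (S : {poly R}) l : bump S l x = 0 by rewrite /bump (negbTE x01).
rewrite fx.
have [KP KP0 hP] : exists2 K, 0 < K & forall y, 0 < y < 1 -> `|P.[y]| <= K.
  have /compact_bounded[K [_ hK]] : compact (horner P @` `[0, 1]).
    apply: continuous_compact; last exact: segment_compact.
    by apply: continuous_subspaceT => y; exact: continuous_horner.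
  exists (`|K| + 1); first by rewrite ltr_wpDl.
  move=> y /andP[y0 y1]; apply: hK; last first.
    by exists y => //=; rewrite in_itv/= !ltW.
  by rewrite ltr_pwDr// ler_norm.
have [Kq Kq0 hq] := bump_quotient_bound k.+2.
apply: (@der_quadratic _ _ _ (KP * Kq)) => y _.
rewrite mul0r subr0 fx subr0 /bump; case: ifPn => y01; last first.
  by rewrite normr0 mulr_ge0 ?sqr_ge0// mulr_ge0// ltW.
have Qy := Q0 _ y01.
rewrite normrM -mulrA ler_pM ?hP//.
rewrite ger0_norm; last by rewrite mulr_ge0 ?expR_ge0// invr_ge0 exprn_ge0// ltW.
(* Two extra powers of Q are taken out of the bounded quotient; they give the quadratic remainder
   because Q(y) <= |y - x| when [x] is outside []0, 1[]. *)
have -> : bumpQ.[y] ^- k * expR (- bumpQ.[y]^-1) =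
    bumpQ.[y] ^- k.+2 * expR (- bumpQ.[y]^-1) * bumpQ.[y] ^+ 2.
  have : bumpQ.[y] ^+ k != 0 by rewrite expf_neq0// gt_eqF.
  rewrite !exprS; move: (lt0r_neq0 Qy); set q := bumpQ.[y]; set qk := q ^+ k.
  by move=> q0 qk0; field; rewrite qk0.
rewrite ler_pM ?sqr_ge0 ?hq//.
  by rewrite mulr_ge0 ?expR_ge0// invr_ge0 exprn_ge0// ltW.
rewrite -[leRHS]real_normK ?num_real// lerXn2r ?nnegrE ?(ltW Qy)//.
rewrite bumpQE; move: y01 x01 => /andP[y0 y1]; rewrite negb_and -!leNgt.
case/orP => x01.
  by rewrite ger0_norm; nra.
by rewrite ler0_norm; nra.
Unshelve. all: by end_near. Qed.

End real_derivatives.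

(** * Smooth bumps of integral one and arbitrarily small support *)

Section bump_families.
Context {R : realType}.
Local Notation is_der x f a := (is_derive (x : R) (1 : R) (f : R -> R) (a : R)).
Local Notation mu := (@lebesgue_measure R).

(* D n is the n-th derivative of D 0; the primitive B expresses that D 0 has
   integral 1. The support is on the right of 0, so that half-open intervals
   [a, b[ are points of continuity in mollify_limit. *)
Definition bump_family (e : R) (D : nat -> R -> R) : Prop :=
  [/\ forall n x, is_der x (D n) (D n.+1 x),
      forall n x, ~~ (0 < x < e) -> D n x = 0,
      forall x, 0 <= D 0 x
    & exists2 B : R -> R, forall x, - e < x -> is_der x B (D 0 x)
                        & B e - B 0 = 1].

Lemma bump_family_exists (e : R) : 0 < e -> exists D, bump_family e D.
Proof.
move=> e0.
(* Each derivative adds two to the order of the pole, so the n-th one has order 2 n. *)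
pose P := fix P n : {poly R} := if n is m.+1 then bumpD (P m) m.*2 else 1.
pose D n := bump (P n) n.*2.
have dD n x : is_der x (D n) (D n.+1 x) by exact: der_bump.
have D0 n x : ~~ (0 < x < 1) -> D n x = 0 by rewrite /D /bump => /negbTE ->.
have Dpos x : 0 < x < 1 -> 0 < D 0 x.
  move=> x01; rewrite /D /bump x01 hornerC mul1r expr0 invr1 mul1r.
  exact: expR_gt0.
(* Starting at -1 makes the primitive differentiable at 0 as well; after rescaling this is the range
   - e < x of [bump_family]. *)
pose B x := \int[mu]_(t in `[(- 1) : R, x]) D 0 t.
have dB x : - 1 < x -> is_der x B (D 0 x).
  move=> x1; have [] := @continuous_FTC1_closed R (D 0) (- 1) x (x + 1) _ _ x1.
  - by rewrite ltrDl.
  - apply: continuous_compact_integrable; first exact: segment_compact.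
    by apply: continuous_subspaceT => t; exact: der_continuous (dD 0 t).
  - exact: der_continuous (dD 0 x).
  - by move=> /derivable_der + <-; exact.
(* The total mass is positive because, by the mean value theorem, it is a value of the bump inside
   []0, 1[]. *)
have [c c01 cB] : exists2 c, c \in `]0, 1[ & B 1 - B 0 = D 0 c * (1 - 0).
  apply: MVT => // [x|].
    by rewrite in_itv/= => /andP[x0 _]; apply: dB;
      rewrite (lt_trans _ x0)// oppr_lt0.
  apply: derivable_within_continuous => x.
  rewrite in_itv/= => /andP[x0 _]; apply: der_derivable (dB x _).
  by rewrite (lt_le_trans _ x0)// oppr_lt0.
have Bc : 0 < B 1 - B 0.
  by rewrite cB subr0 mulr1 Dpos//; rewrite in_itv in c01.
set m := B 1 - B 0 in Bc.
have en0 := lt0r_neq0 e0.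
have de x : is_der x (fun t => e^-1 * t) e^-1.
  by apply: (is_derive_eq (derZ e^-1 (der_id x))); rewrite mulr1.
(* One factor 1 / e keeps the mass under rescaling, and each derivative produces another. *)
exists (fun n x => m^-1 * (e ^- n.+1 * D n (e^-1 * x))); split.
- move=> n x; apply: (is_derive_eq
    (derZ _ (derZ _ (der_comp (de x) (dD n (e^-1 * x)))))).
  have : e ^+ n != 0 by rewrite expf_neq0.
  rewrite !exprS; set en := e ^+ n => en1; field.
  by rewrite en1 en0 gt_eqF.
- move=> n x xe; rewrite D0 ?mulr0//; apply: contra xe => /andP[h1 h2].
  by move: h1 h2; rewrite pmulr_rgt0 ?invr_gt0// mulrC ltr_pdivrMr ?mul1r// => ->.
- move=> x; rewrite mulr_ge0 ?invr_ge0 ?(ltW Bc)// mulr_ge0 ?invr_ge0 ?exprn_ge0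
  ?(ltW e0)//.
  by have [/Dpos/ltW|/D0 ->] := boolP (0 < e^-1 * x < 1).
- exists (fun x => m^-1 * B (e^-1 * x)) => [x xe|].
    apply: (is_derive_eq (derZ _ (der_comp (de x) (dB (e^-1 * x) _)))).
      by rewrite mulrC ltr_pdivlMr// mulN1r.
    by rewrite expr1 (mulrC (D _ _)).
  by rewrite mulVf// mulr0 -mulrBr mulVf// gt_eqF.
Qed.

Lemma bump_family_integral1 (e : R) D (x : R) : 0 < e -> bump_family e D ->
  (\int[mu]_w (D 0 (x - w))%:E = 1)%E /\ (\int[mu]_w (D 0 (w - x))%:E = 1)%E.
Proof.
move=> e0 [dD D0 Dge0 [B dB B1]].
have FTC (F f : R -> R) (a b : R) : a < b -> (forall t, {for t, continuous f}) ->
    (forall t, t \in `[a, b] -> is_der t F (f t)) ->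
    (forall t, t \notin `]a, b[ -> f t = 0) -> F b - F a = 1 ->
    (\int[mu]_w (f w)%:E = 1)%E.
  move=> ab cf dF f0 F1.
  transitivity (\int[mu]_(w in `[a, b]) (f w)%:E)%E.
    rewrite [RHS]integral_mkcond/=; apply: eq_integral => w _.
    rewrite patchE; case: ifPn => // wab; rewrite f0//.
    apply: contra wab => wab; rewrite inE /=.
    by move: wab; rewrite !in_itv/= => /andP[? ?]; rewrite !ltW.
  rewrite (@continuous_FTC2 _ f F)// ?F1//.
  - by rewrite -EFinB F1.
  - exact: continuous_subspaceT.
  - split.
    + move=> t tab; apply: der_derivable (dF t _).
      by move: tab; rewrite !in_itv/= => /andP[? ?]; rewrite !ltW.
    + apply: cvg_at_right_filter; apply: der_continuous (dF a _).
      by rewrite in_itv/= lexx ltW.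
    + apply: cvg_at_left_filter; apply: der_continuous (dF b _).
      by rewrite in_itv/= lexx ltW.
  - move=> t tab; apply: der_derive1 (dF t _).
    by move: tab; rewrite !in_itv/= => /andP[? ?]; rewrite !ltW.
have d1 t : is_der t (fun w => x - w) (- 1).
  by apply: (is_derive_eq (derB (derC x t) (der_id t))); rewrite sub0r.
have d2 t : is_der t (fun w => w - x) 1.
  by apply: (is_derive_eq (derB (der_id t) (derC x t))); rewrite subr0.
split.
- apply: (FTC (fun w => - B (x - w)) (fun w : R => D 0 (x - w)) (x - e) x).
  + by rewrite ltrBlDr ltrDl.
  + by move=> t; exact: (der_continuous (der_comp (d1 t) (dD 0 (x - t)))).
  + move=> t; rewrite in_itv/= => /andP[t1 t2].
    apply: (is_derive_eq (derN (der_comp (d1 t) (dB (x - t) _)))).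
      by rewrite (@lt_le_trans _ _ 0)// ?oppr_lt0// subr_ge0.
    by rewrite mulrN1 opprK.
  + move=> t tab; apply: D0; apply: contra tab => /andP[? ?].
    by rewrite in_itv/=; apply/andP; split; lra.
  + by rewrite subrr opprK addrC subKr.
- apply: (FTC (fun w => B (w - x)) (fun w : R => D 0 (w - x)) x (x + e)).
  + by rewrite ltrDl.
  + by move=> t; exact: (der_continuous (der_comp (d2 t) (dD 0 (t - x)))).
  + move=> t; rewrite in_itv/= => /andP[t1 t2].
    apply: (is_derive_eq (der_comp (d2 t) (dB (t - x) _))).
      by rewrite (@lt_le_trans _ _ 0)// ?oppr_lt0// subr_ge0.
    by rewrite mulr1.
  + move=> t tab; apply: D0; apply: contra tab => /andP[? ?].
    by rewrite in_itv/=; apply/andP; split; lra.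
  + by rewrite subrr (addrC x) addrK.
Qed.

Lemma bump_family_bounded (e : R) D n : 0 < e -> bump_family e D ->
  exists2 K, 0 < K & forall x, `|D n x| <= K.
Proof.
move=> e0 [dD D0 _ _].
have /compact_bounded[K [_ hK]] : compact (D n @` `[0, e]).
  apply: continuous_compact; last exact: segment_compact.
  by apply: continuous_subspaceT => y; exact: der_continuous (dD n y).
exists (`|K| + 1); first by rewrite ltr_wpDl.
move=> x; have [/andP[x0 xe]|/D0 ->] := boolP (0 < x < e); last first.
  by rewrite normr0 addr_ge0.
apply: hK; first by rewrite ltr_pwDr// ler_norm.
by exists x => //=; rewrite in_itv/= !ltW.
Qed.

(** The mean value theorem, applied once and then again to the next derivative. The constant is
    uniform in both points, so the estimates can later be integrated against a locally integrable
    function. *)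
Lemma bump_family_quadratic (e : R) D n : 0 < e -> bump_family e D ->
  exists2 K, 0 < K & forall x y,
    `|D n y - D n x| <= K * `|y - x| /\
    `|D n y - D n x - D n.+1 x * (y - x)| <= K * (y - x) ^+ 2.
Proof.
move=> e0 DD; have [K1 K10 hK1] := bump_family_bounded n.+1 e0 DD.
have [K2 K20 hK2] := bump_family_bounded n.+2 e0 DD.
have [dD _ _ _] := DD.
have lip m K : (forall x, `|D m.+1 x| <= K) ->
    forall x y, `|D m y - D m x| <= K * `|y - x|.
  move=> hK; have main x y : x < y -> `|D m y - D m x| <= K * `|y - x|.
    move=> xy; have [c _ ->] : exists2 c, c \in `]x, y[ &
        D m y - D m x = D m.+1 c * (y - x).
      apply: MVT => //; apply: continuous_subspaceT => t.
      exact: der_continuous (dD m t).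
    by rewrite normrM ler_wpM2r.
  move=> x y; have [xy|xy|->] := ltgtP x y; first exact: main.
    by rewrite distrC (distrC y); exact: main.
  by rewrite !subrr normr0 mulr0.
exists (K1 + K2); first exact: addr_gt0.
move=> x y; split.
  by rewrite (le_trans (lip n K1 hK1 x y))// ler_wpM2r// lerDl ltW.
have [c cxy ->] : exists2 c, `|c - x| <= `|y - x| &
    D n y - D n x = D n.+1 c * (y - x).
  have [xy|xy|->] := ltgtP x y; last by exists y; rewrite ?subrr ?mulr0.
  - have [c cxy cE] : exists2 c, c \in `]x, y[ &
        D n y - D n x = D n.+1 c * (y - x).
      apply: MVT => //; apply: continuous_subspaceT => t.
      exact: der_continuous (dD n t).
    exists c => //; move: cxy; rewrite in_itv/= => /andP[? ?].
    by rewrite !ger0_norm ?subr_ge0 ?ltW//; lra.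
  - have [c cxy cE] : exists2 c, c \in `]y, x[ &
        D n x - D n y = D n.+1 c * (x - y).
      apply: MVT => //; apply: continuous_subspaceT => t.
      exact: der_continuous (dD n t).
    exists c; last by rewrite -[LHS]opprB cE -mulrN opprB.
    move: cxy; rewrite in_itv/= => /andP[? ?].
    by rewrite !ler0_norm ?subr_le0 ?ltW//; lra.
rewrite -mulrBl normrM -(real_normK (num_real (y - x))) expr2 mulrA ler_wpM2r//.
rewrite (le_trans (lip n.+1 K2 hK2 _ _))// ler_pM ?(ltW K20)//.
by rewrite lerDr ltW.
Qed.

End bump_families.

(** * Integration and convolution on the plane *)

Section plane_integrals.
Context {R : realType}.
Local Notation plane := (measurableTypeR R * measurableTypeR R)%type.
Local Notation mu := (@lebesgue_measure R).

(** The measure [area] under a head constant of its own, to which the sigma-finiteness used by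
    Fubini's theorem is attached. *)
Definition planeM : set plane -> \bar R := (mu \x mu)%E.

HB.instance Definition _ := Measure.on planeM.

Lemma planeM_rect (a b c d : R) : planeM (`[a, b] `*` `[c, d]) \is a fin_num.
Proof.
rewrite /planeM /= product_measure1E; [|exact: measurable_itv..].
have fm (x y : R) : mu `[x, y] \is a fin_num.
  by rewrite lebesgue_measure_itv/=; case: ifPn.
by apply: fin_numM; exact: fm.
Qed.

Lemma planeM_sigma_finite : sigma_finite setT planeM.
Proof.
exists (fun n => box n%:R) => [|n]; last first.
  by split; [exact: measurable_box|rewrite ltey_eq planeM_rect].
apply/esym; rewrite -subTset => -[x y] _.
exists (Num.trunc (`|x| + `|y|)).+1 => //; apply/boxP => /=.
have hn : `|x| + `|y| <= (Num.trunc (`|x| + `|y|)).+1%:R.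
  by rewrite ltW// truncnS_gt.
by split; apply: le_trans hn; rewrite ?lerDl ?lerDr.
Qed.

HB.instance Definition _ :=
  Measure_isSigmaFinite.Build _ _ _ planeM planeM_sigma_finite.

Definition integ (f : R * R -> R) : Prop :=
  planeM.-integrable setT (EFin \o (f : plane -> R)).

Definition pint (f : R * R -> R) : R := \int[planeM]_p f p.

Lemma integ_measurable f : integ f -> measurable_fun setT (f : plane -> R).
Proof. by move=> /measurable_int/measurable_EFinP. Qed.

Lemma eq_integ f g : (forall p, f p = g p) -> integ f -> integ g.
Proof. by move=> fg; have -> : f = g by apply/funext. Qed.

Lemma integD f g : integ f -> integ g -> integ (fun p => f p + g p).
Proof. by move=> fi gi; exact: (integrableD measurableT fi gi). Qed.

Lemma integZ k f : integ f -> integ (fun p => k * f p).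
Proof. by move=> fi; exact: (integrableZl measurableT k fi). Qed.

Lemma integB f g : integ f -> integ g -> integ (fun p => f p - g p).
Proof. by move=> fi gi; exact: (integrableB measurableT fi gi). Qed.

Lemma integ_le f g : measurable_fun setT (f : plane -> R) -> integ g ->
  (forall p, `|f p| <= g p) -> integ f.
Proof.
move=> mf ig fg; apply: (le_integrable measurableT _ _ ig).
  exact/measurable_EFinP.
move=> p _; rewrite /= lee_fin (le_trans (fg p))//.
by rewrite ler_norm.
Qed.

Lemma integ_norm f : integ f -> integ (fun p => `|f p|).
Proof. exact: integrable_norm. Qed.

Lemma eq_pint f g : (forall p, f p = g p) -> pint f = pint g.
Proof. by move=> fg; congr pint; apply/funext. Qed.

Lemma pintD f g : integ f -> integ g ->
  pint (fun p => f p + g p) = pint f + pint g.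
Proof. by move=> fi gi; exact: RintegralD. Qed.

Lemma pintB f g : integ f -> integ g ->
  pint (fun p => f p - g p) = pint f - pint g.
Proof. by move=> fi gi; exact: RintegralB. Qed.

Lemma pintZ k f : integ f -> pint (fun p => k * f p) = k * pint f.
Proof. by move=> fi; exact: RintegralZl. Qed.

Lemma le_pint f g : integ f -> integ g -> (forall p, f p <= g p) ->
  pint f <= pint g.
Proof. by move=> fi gi fg; exact: le_Rintegral. Qed.

Lemma pint_ge0 f : (forall p, 0 <= f p) -> 0 <= pint f.
Proof. by move=> f0; apply: Rintegral_ge0. Qed.

Lemma le_norm_pint f : integ f -> `|pint f| <= pint (fun p => `|f p|).
Proof. by move=> fi; exact: le_normr_Rintegral. Qed.

Definition ibox (M : R) (p : R * R) : R := \1_(box M) p.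

Lemma ibox_ge0 M p : 0 <= ibox M p. Proof. by rewrite /ibox indicE. Qed.

Lemma measurable_ibox M : measurable_fun setT (ibox M : plane -> R).
Proof. by apply: measurable_indic; exact: measurable_box. Qed.

Lemma integ_ibox M : integ (ibox M).
Proof.
apply/integrableP; split.
  by apply/measurable_EFinP; exact: measurable_ibox.
rewrite (eq_integral (fun p : plane => (\1_(box M : set plane) p)%:E));
  last first.
  by move=> p _; rewrite /= ger0_norm// ibox_ge0.
rewrite integral_indic//; last exact: measurable_box.
by rewrite setIT ltey_eq planeM_rect.
Qed.

(** Squares exhaust the plane, so they stand for all compact sets; multiplying by an indicator keeps
    every integral over the whole plane. *)
Definition locint (g : R * R -> R) : Prop :=
  measurable_fun setT (g : plane -> R) /\
  forall M, integ (fun p => g p * ibox M p).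

(** The explicit bound turns uniform estimates on kernels into estimates on convolutions. *)
Lemma locint_mul g h M K : locint g ->
  measurable_fun setT (h : plane -> R) -> (forall p, `|h p| <= K) ->
  (forall p, ~ box M p -> h p = 0) -> integ (fun p => g p * h p) /\
  `|pint (fun p => g p * h p)| <= K * pint (fun p => `|g p * ibox M p|).
Proof.
move=> [mg gi] mh hK h0.
have H p : `|g p * h p| <= K * `|g p * ibox M p|.
  have [pM|/h0 ->] := pselect (box M p); last first.
    rewrite mulr0 normr0 mulr_ge0// (le_trans (normr_ge0 (h p)))//.
  rewrite !normrM (mulrCA K) ler_wpM2l//.
  by rewrite /ibox indicE mem_set// normr1 mulr1.
have i1 : integ (fun p => g p * h p).
  apply: (integ_le (g := fun p => K * `|g p * ibox M p|)) => //.
    exact: measurable_funM.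
  exact/integZ/integ_norm.
split=> //; rewrite -pintZ; last exact: integ_norm.
apply: (le_trans (le_norm_pint i1)); apply: le_pint => //.
  exact: integ_norm.
exact/integZ/integ_norm.
Qed.

Lemma locint_continuous g : continuous g -> locint g.
Proof.
move=> cg; split; first exact: continuous_plane_measurable.
move=> M; have [K K0 hK] := continuous_box_bounded M cg.
apply: (integ_le (g := fun p => K * ibox M p)).
- apply: measurable_funM; first exact: continuous_plane_measurable.
  exact: measurable_ibox.
- exact/integZ/integ_ibox.
- move=> p; have [pM|pM] := pselect (box M p).
    by rewrite /ibox indicE mem_set// !mulr1 hK.
  by rewrite /ibox indicE memNset// !mulr0 normr0.
Qed.

Lemma locintD f g : locint f -> locint g -> locint (fun p => f p + g p).
Proof.
move=> [mf fi] [mg gi]; split; first exact: measurable_funD.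
move=> M; apply: eq_integ (integD (fi M) (gi M)) => p.
by rewrite mulrDl.
Qed.

Lemma locintB f g : locint f -> locint g -> locint (fun p => f p - g p).
Proof.
move=> [mf fi] [mg gi]; split; first exact: measurable_funB.
move=> M; apply: eq_integ (integB (fi M) (gi M)) => p.
by rewrite mulrBl.
Qed.

End plane_integrals.

(** * Convolution of a locally integrable function with a smooth kernel *)

Section convolution.
Context {R : realType}.
Local Notation plane := (measurableTypeR R * measurableTypeR R)%type.
Local Notation is_der x f a := (is_derive (x : R) (1 : R) (f : R -> R) (a : R)).
Implicit Types (g k : R * R -> R) (z w u : R * R).

(** The support is confined to one fixed square so that nearby translates share a box; this is where
    the condition e <= 1 on bumps comes from. *)
Definition kernel k : Prop :=
  [/\ continuous k, exists2 K, 0 < K & forall u, `|k u| <= K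
    & forall u, ~ box 1 u -> k u = 0].

Definition conv g k z : R := pint (fun w => g w * k (z - w)).

Lemma continuous_subl z : continuous (fun w => z - w).
Proof. by move=> w; apply: cvgB; [exact: cvg_cst|exact: cvg_id]. Qed.

Lemma continuous_kernel_sub k z : continuous k -> continuous (fun w => k (z - w)).
Proof.
move=> ck w; apply: (continuous_comp (f := fun w => z - w)).
  exact: continuous_subl.
exact: ck.
Qed.

(** In the radius, one unit pays for the move from [z] to [z'] and one for the support of the
    kernel. The box depends on [z] only, so increments of a convolution are integrals over a fixed
    compact set. *)
Lemma kernel_sub0 k z z' w : kernel k -> `|z'.1 - z.1| <= 1 ->
  `|z'.2 - z.2| <= 1 -> ~ box (`|z.1| + `|z.2| + 2) w -> k (z' - w) = 0.
Proof.
move=> [_ _ k0] z1 z2 wM; apply: k0 => /boxP[/= h1 h2]; apply: wM; apply/boxP.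
have n1 := normr_ge0 z.1; have n2 := normr_ge0 z.2.
split.
- have -> : w.1 = z.1 + ((z'.1 - z.1) - (z'.1 - w.1)) by ring.
  rewrite (le_trans (ler_normD _ _))// -(addrA `|z.1|) lerD2l.
  by rewrite (le_trans (ler_normB _ _))//; lra.
- have -> : w.2 = z.2 + ((z'.2 - z.2) - (z'.2 - w.2)) by ring.
  rewrite (le_trans (ler_normD _ _))//.
  rewrite (addrC `|z.1|) -(addrA `|z.2|) lerD2l.
  by rewrite (le_trans (ler_normB _ _))//; lra.
Qed.

Lemma conv_integ g k z : locint g -> kernel k ->
  integ (fun w => g w * k (z - w)).
Proof.
move=> gi kk; have [ck [K _ hK] k0] := kk.
have [] // := @locint_mul _ g (fun w => k (z - w)) (`|z.1| + `|z.2| + 2) K gi.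
- by apply: continuous_plane_measurable; exact: continuous_kernel_sub.
- by move=> w wM; apply: kernel_sub0 wM => //; rewrite subrr normr0.
Qed.

(** Replaces differentiation under the integral sign: a bound on the kernel uniform in [u] is
    integrated against |g|. With c = 0 it yields continuity, with [c] the increment of a coordinate
    it yields a derivative. *)
Lemma conv_expansion g k k' z z' (c E : R) : locint g -> kernel k -> kernel k' ->
  `|z'.1 - z.1| <= 1 -> `|z'.2 - z.2| <= 1 ->
  (forall u, `|k (z' - z + u) - k u - c * k' u| <= E) ->
  `|conv g k z' - conv g k z - c * conv g k' z| <=
    E * pint (fun w => `|g w * ibox (`|z.1| + `|z.2| + 2) w|).
Proof.
move=> gi kk kk' z1 z2 hE; have [ck _ _] := kk; have [ck' _ _] := kk'.
have i1 := conv_integ z' gi kk; have i2 := conv_integ z gi kk.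
have i3 := conv_integ z gi kk'.
rewrite /conv -(pintB i1 i2) -(pintZ c i3) -(pintB (integB i1 i2) (integZ c i3)).
rewrite (@eq_pint _ _ (fun w =>
      g w * (k (z' - w) - k (z - w) - c * k' (z - w)))); last first.
    by move=> w; ring.
have [] // := @locint_mul _ g (fun w => k (z' - w) - k (z - w) - c * k' (z - w))
  (`|z.1| + `|z.2| + 2) E gi.
- apply: measurable_funB; first apply: measurable_funB.
  + by apply: continuous_plane_measurable; exact: continuous_kernel_sub.
  + by apply: continuous_plane_measurable; exact: continuous_kernel_sub.
  + apply: measurable_funM => //.
    by apply: continuous_plane_measurable; exact: continuous_kernel_sub.
- by move=> w; have := hE (z - w); rewrite addrA subrK.
- move=> w wM; rewrite !(kernel_sub0 (z := z) _ _ _ wM)//;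
    by rewrite ?subrr ?normr0 ?mulr0 ?subrr.
Qed.

Definition xquadratic k k' := exists2 C, 0 < C & forall t u,
  `|k (t + u.1, u.2) - k u - t * k' u| <= C * t ^+ 2.
Definition yquadratic k k' := exists2 C, 0 < C & forall t u,
  `|k (u.1, t + u.2) - k u - t * k' u| <= C * t ^+ 2.
Definition lipschitz2 k := exists2 C, 0 < C & forall u v,
  `|k (v + u) - k u| <= C * (`|v.1| + `|v.2|).

Lemma conv_dx g k k' x y : locint g -> kernel k -> kernel k' ->
  xquadratic k k' -> is_der x (fun t => conv g k (t, y)) (conv g k' (x, y)).
Proof.
move=> gi kk kk' [C C0 hC].
apply: (@der_quadratic _ _ _ _
  (C * pint (fun w => `|g w * ibox (`|x| + `|y| + 2) w|))) => t xt.
rewrite [conv g k' _ * _]mulrC (mulrAC C).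
apply: (conv_expansion (z := (x, y)) (z' := (t, y))) => //=.
  by rewrite subrr normr0.
move=> [a b].
have -> : (t, y) - (x, y) + (a, b) = (t - x + a, y - y + b) by [].
by rewrite subrr add0r; exact: hC (t - x) (a, b).
Qed.

Lemma conv_dy g k k' x y : locint g -> kernel k -> kernel k' ->
  yquadratic k k' -> is_der y (fun t => conv g k (x, t)) (conv g k' (x, y)).
Proof.
move=> gi kk kk' [C C0 hC].
apply: (@der_quadratic _ _ _ _
  (C * pint (fun w => `|g w * ibox (`|x| + `|y| + 2) w|))) => t xt.
rewrite [conv g k' _ * _]mulrC (mulrAC C).
apply: (conv_expansion (z := (x, y)) (z' := (x, t))) => //=.
  by rewrite subrr normr0.
move=> [a b].
have -> : (x, t) - (x, y) + (a, b) = (x - x + a, t - y + b) by [].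
by rewrite subrr add0r; exact: hC (t - y) (a, b).
Qed.

Lemma conv_continuous g k : locint g -> kernel k -> lipschitz2 k ->
  continuous (conv g k).
Proof.
move=> gi kk [C C0 hC] z; set N := pint (fun w => `|g w * ibox (`|z.1| + `|z.2|
  + 2) w|).
have N0 : 0 <= N by apply: pint_ge0.
apply/cvgrPdist_le => /= e e0.
(* The 2 accounts for the two coordinates, and N + 1 avoids dividing by a vanishing N. *)
have d0 : 0 < e / (2 * C * (N + 1)).
  by rewrite divr_gt0// !mulr_gt0// ltr_wpDl.
near=> z'.
have z1 : `|z'.1 - z.1| <= 1 /\ `|z'.1 - z.1| <= e / (2 * C * (N + 1)).
  near: z'; case: (z) => a b /=.
  exists (ball a (Num.min 1 (e / (2 * C * (N + 1)))), setT) => /=.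
    split; last exact: filterT.
    by apply: nbhsx_ballx; rewrite lt_min ltr01.
  by move=> [c d] [/= + _]; rewrite /ball/= lt_min distrC => /andP[? ?];
    rewrite !ltW.
have z2 : `|z'.2 - z.2| <= 1 /\ `|z'.2 - z.2| <= e / (2 * C * (N + 1)).
  near: z'; case: (z) => a b /=.
  exists (setT, ball b (Num.min 1 (e / (2 * C * (N + 1))))) => /=.
    split; first exact: filterT.
    by apply: nbhsx_ballx; rewrite lt_min ltr01.
  by move=> [c d] [/= _]; rewrite /ball/= lt_min distrC => /andP[? ?];
    rewrite !ltW.
have h : `|conv g k z' - conv g k z| <= C * (`|z'.1 - z.1| + `|z'.2 - z.2|) * N.
  (* A derivative term with coefficient 0 is inserted to match [conv_expansion]. *)
  rewrite -[X in `|X|]subr0 -(mul0r (conv g k z)).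
  apply: (conv_expansion gi kk kk z1.1 z2.1) => u.
  by rewrite mul0r subr0; exact: hC (z' - z).
rewrite distrC (le_trans h)//.
rewrite (@le_trans _ _ (C * (2 * (e / (2 * C * (N + 1)))) * (N + 1)))//.
  rewrite ler_pM ?mulr_ge0 ?addr_ge0 ?(ltW C0)//; last by rewrite lerDl.
  rewrite ler_wpM2l ?(ltW C0)//.
  by rewrite mulr_natl mulr2n lerD// ?z1.2 ?z2.2.
rewrite le_eqVlt; apply/orP; left; apply/eqP; field.
by rewrite !gt_eqF// ltr_wpDl.
Unshelve. all: by end_near. Qed.

(** A tensor product indexed by the numbers of derivatives in x and in y: partial derivatives only
    shift an index, and mixed ones commute by construction. *)
Definition bkernel (D : nat -> R -> R) i j u : R := D i u.1 * D j u.2.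

Lemma bkernelP e D i j : 0 < e <= 1 -> bump_family e D ->
  [/\ kernel (bkernel D i j), lipschitz2 (bkernel D i j),
      xquadratic (bkernel D i j) (bkernel D i.+1 j)
    & yquadratic (bkernel D i j) (bkernel D i j.+1)].
Proof.
move=> /andP[e0 e1] DD.
have [K1 K10 h1] := bump_family_bounded i e0 DD.
have [K2 K20 h2] := bump_family_bounded j e0 DD.
have [L1 L10 q1] := bump_family_quadratic i e0 DD.
have [L2 L20 q2] := bump_family_quadratic j e0 DD.
have [dD D0 _ _] := DD.
split.
- split.
  + move=> u; apply: cvgM.
      apply: (continuous_comp (f := fst)); first exact: cvg_fst.
      exact: der_continuous (dD i u.1).
    apply: (continuous_comp (f := snd)); first exact: cvg_snd.
    exact: der_continuous (dD j u.2).
  + by exists (K1 * K2); [exact: mulr_gt0|move=> u; rewrite normrM ler_pM].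
  + move=> u nu; rewrite /bkernel.
    have [u1|/D0 ->] := boolP (0 < u.1 < e); last by rewrite mul0r.
    have [u2|/D0 ->] := boolP (0 < u.2 < e); last by rewrite mulr0.
    case: nu; apply/boxP; move: u1 u2 => /andP[? ?] /andP[? ?].
    by rewrite !gtr0_norm//; split; apply: (le_trans _ e1); exact: ltW.
- exists (L1 * K2 + K1 * L2); first by rewrite addr_gt0// mulr_gt0.
  move=> [a b] [s t]; rewrite /bkernel /=.
  have -> : D i (s + a) * D j (t + b) - D i a * D j b =
    (D i (s + a) - D i a) * D j (t + b) + D i a * (D j (t + b) - D j b) by ring.
  rewrite (le_trans (ler_normD _ _))// !normrM.
  have := (q1 a (s + a)).1; have := (q2 b (t + b)).1; rewrite !addrK => qb qa.
  rewrite (@le_trans _ _ (L1 * `|s| * K2 + K1 * (L2 * `|t|)))//.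
    by rewrite lerD// ler_pM.
  rewrite -subr_ge0.
  rewrite (_ : _ - _ = L1 * K2 * `|t| + K1 * L2 * `|s|); last by ring.
  by rewrite addr_ge0// mulr_ge0// mulr_ge0// ltW.
- exists (L1 * K2); first exact: mulr_gt0.
  move=> t [a b]; rewrite /bkernel /=.
  have -> : D i (t + a) * D j b - D i a * D j b - t * (D i.+1 a * D j b) =
    (D i (t + a) - D i a - D i.+1 a * t) * D j b by ring.
  rewrite normrM mulrAC ler_pM//.
  by have := (q1 a (t + a)).2; rewrite addrK.
- exists (K1 * L2); first exact: mulr_gt0.
  move=> t [a b]; rewrite /bkernel /=.
  have -> : D i a * D j (t + b) - D i a * D j b - t * (D i a * D j.+1 b) =
    D i a * (D j (t + b) - D j b - D j.+1 b * t) by ring.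
  rewrite normrM -mulrA ler_pM//.
  by have := (q2 b (t + b)).2; rewrite addrK.
Qed.

End convolution.

(** * Mollification: mass, Jensen's inequality, duality and limits *)

Section mollification.
Context {R : realType}.
Local Notation plane := (measurableTypeR R * measurableTypeR R)%type.
Local Notation mu := (@lebesgue_measure R).
Implicit Types (g k chi : R * R -> R) (z w u : R * R) (D : nat -> R -> R).

Lemma EFin_pint (f : R * R -> R) : integ f ->
  (\int[planeM]_p (f p)%:E)%E = (pint f)%:E.
Proof. by move=> fi; rewrite fineK//; exact: integrable_fin_num. Qed.

Lemma kernel_integ k z : kernel k -> integ (fun w => k (z - w)).
Proof.
move=> kk; have c1 : continuous (fun _ : R * R => 1 : R) by move=> ?;
  exact: cvg_cst.
by apply: eq_integ (conv_integ z (locint_continuous c1) kk) => w; rewrite mul1r.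
Qed.

(** Both orientations occur: the first normalizes [conv] in Jensen's inequality, the second
    normalizes the averages of a test function obtained from Fubini's theorem. *)
Lemma bkernel_mass e D z : 0 < e <= 1 -> bump_family e D ->
  pint (fun w => bkernel D 0 0 (z - w)) = 1 /\
  pint (fun w => bkernel D 0 0 (w - z)) = 1.
Proof.
move=> e01 DD; have [kk _ _ _] := bkernelP 0 0 e01 DD.
have [ck _ _] := kk; have [_ _ D0 _] := DD.
have e0 : 0 < e by case/andP: e01.
have dec (a b : R -> R) : measurable_fun setT (a : measurableTypeR R -> R) ->
    measurable_fun setT (b : measurableTypeR R -> R) ->
    (forall x, 0 <= a x) -> (forall x, 0 <= b x) ->
    (\int[mu]_x (a x)%:E = 1)%E -> (\int[mu]_x (b x)%:E = 1)%E ->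
    (\int[planeM]_p (a p.1 * b p.2)%:E = 1)%E.
  move=> ma mb a0 b0 ia ib; rewrite /planeM fubini_tonelli1; last 2 first.
  - apply/measurable_EFinP; apply: measurable_funM.
      exact: measurableT_comp ma measurable_fst.
    exact: measurableT_comp mb measurable_snd.
  - by move=> p; rewrite lee_fin mulr_ge0.
  rewrite -[RHS]ia; apply: eq_integral => x _; rewrite /fubini_F /=.
  under eq_integral do rewrite EFinM.
  rewrite ge0_integralZl//; first by rewrite ib mule1.
  - exact/measurable_EFinP.
  - by move=> y _; rewrite lee_fin.
  - by rewrite lee_fin.
have cD n : continuous (D n) by move=> x; case: DD => dD _ _ _;
  exact: der_continuous (dD n x).
have csub (t : R) : continuous (fun w : R => t - w).
  by move=> w; apply: cvgB; [exact: cvg_cst|exact: cvg_id].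
have csub' (t : R) : continuous (fun w : R => w - t).
  by move=> w; apply: cvgB; [exact: cvg_id|exact: cvg_cst].
split; rewrite /pint /Rintegral.
- rewrite (dec (fun x => D 0 (z.1 - x)) (fun x => D 0 (z.2 - x)))//.
  + apply: continuous_measurable_fun => w.
    by apply: (continuous_comp (f := fun t : R => z.1 - t));
      [exact: csub|exact: cD].
  + apply: continuous_measurable_fun => w.
    by apply: (continuous_comp (f := fun t : R => z.2 - t));
      [exact: csub|exact: cD].
  + exact: (bump_family_integral1 z.1 e0 DD).1.
  + exact: (bump_family_integral1 z.2 e0 DD).1.
- rewrite (dec (fun x => D 0 (x - z.1)) (fun x => D 0 (x - z.2)))//.
  + apply: continuous_measurable_fun => w.
    by apply: (continuous_comp (f := fun t : R => t - z.1));
      [exact: csub'|exact: cD].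
  + apply: continuous_measurable_fun => w.
    by apply: (continuous_comp (f := fun t : R => t - z.2));
      [exact: csub'|exact: cD].
  + exact: (bump_family_integral1 z.1 e0 DD).2.
  + exact: (bump_family_integral1 z.2 e0 DD).2.
Qed.

(* Integrate 2 t g - t^2 <= g^2 against the kernel, with t its average of g. *)
Lemma conv_jensen g e D z : 0 < e <= 1 -> bump_family e D ->
  locint g -> locint (fun p => g p ^+ 2) ->
  conv g (bkernel D 0 0) z ^+ 2 <= conv (fun p => g p ^+ 2) (bkernel D 0 0) z.
Proof.
move=> e01 DD gi g2i; have [kk _ _ _] := bkernelP 0 0 e01 DD.
set t := conv g _ z.
have i1 := conv_integ z gi kk; have i2 := conv_integ z g2i kk.
have i3 := kernel_integ z kk.
have [_ _ D0 _] := DD.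
suff : pint (fun w => (2 * t) * (g w * bkernel D 0 0 (z - w)) -
    t ^+ 2 * bkernel D 0 0 (z - w)) <= conv (fun p => g p ^+ 2) (bkernel D 0 0) z.
  rewrite (pintB (integZ _ i1) (integZ _ i3)) (pintZ _ i1) (pintZ _ i3).
  rewrite (bkernel_mass z e01 DD).1 -/(conv g (bkernel D 0 0) z) -/t => h.
  by apply: le_trans h; rewrite (_ : _ - _ = t ^+ 2)//; ring.
apply: le_pint => //; first by apply: integB; exact: integZ.
move=> w; rewrite mulrA -mulrBl ler_wpM2r ?mulr_ge0//.
by rewrite -subr_ge0 (_ : _ - _ = (g w - t) ^+ 2) ?sqr_ge0//; ring.
Qed.

(** Fubini's theorem moves the kernel from [g], which is only locally integrable, to the bounded
    function [chi], whose averages can be controlled pointwise. *)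
Lemma conv_adjoint g k chi M K : locint g -> kernel k ->
  measurable_fun setT (chi : plane -> R) -> (forall z, `|chi z| <= K) ->
  (forall z, ~ box M z -> chi z = 0) ->
  [/\ integ (fun w => g w * pint (fun z => chi z * k (z - w))) &
  pint (fun z => chi z * conv g k z) =
  pint (fun w => g w * pint (fun z => chi z * k (z - w)))].
Proof.
move=> gi kk mchi hK chi0; have [ck [C C0 hC] k0] := kk.
have K0 : 0 <= K by apply: le_trans (hK (0, 0)).
pose F (p : plane * plane) : R := chi p.1 * (g p.2 * k (p.1 - p.2)).
have mF : measurable_fun setT F.
  apply: measurable_funM; first exact: measurableT_comp mchi measurable_fst.
  apply: measurable_funM; first exact: measurableT_comp gi.1 measurable_snd.
  have mk := continuous_plane_measurable ck.
  apply: (measurableT_comp mk).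
  have -> : (fun x : plane * plane => x.1 - x.2 : R * R) =
      (fun x => (x.1.1 - x.2.1, x.1.2 - x.2.2)) by apply/funext => x.
  apply: measurable_fun_pair; apply: measurable_funB.
  - exact: (measurableT_comp measurable_fst measurable_fst).
  - exact: (measurableT_comp measurable_fst measurable_snd).
  - exact: (measurableT_comp measurable_snd measurable_fst).
  - exact: (measurableT_comp measurable_snd measurable_snd).
pose N := pint (fun w => `|g w * ibox (M + 1) w|).
have iN : integ (fun w => `|g w * ibox (M + 1) w|) by apply: integ_norm;
  exact: gi.2.
have kbox z w : box M z -> ~ box (M + 1) w -> k (z - w) = 0.
  move=> /boxP[z1 z2] wM; apply: k0 => /boxP[/= h1 h2]; apply: wM; apply/boxP.
  split.
    have -> : w.1 = z.1 - (z.1 - w.1) by ring.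
    by rewrite (le_trans (ler_normB _ _))// lerD.
  have -> : w.2 = z.2 - (z.2 - w.2) by ring.
  by rewrite (le_trans (ler_normB _ _))// lerD.
(* A majorant with separated variables gives integrability on the product of the two planes. *)
have Fle z w : `|F (z, w)| <= K * C * ibox M z * `|g w * ibox (M + 1) w|.
  rewrite /F /=; have [zM|zM] := pselect (box M z); last first.
    by rewrite chi0// mul0r normr0 !mulr_ge0// ?ibox_ge0// ltW.
  have [wM|wM] := pselect (box (M + 1) w); last first.
    by rewrite kbox// !mulr0 normr0 !mulr_ge0// ?ibox_ge0// ltW.
  rewrite /ibox !indicE !mem_set// !mulr1 !normrM -mulrA ler_pM//.
  by rewrite mulrC ler_pM.
have iF : (planeM \x planeM)%E.-integrable setT (EFin \o F).
  apply/integrable12ltyP; first exact/measurable_EFinP.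
  apply: (@le_lt_trans _ _ (\int[planeM]_z (K * C * N * ibox M z)%:E)%E).
    apply: ge0_le_integral => //=.
    - by move=> z _; apply: integral_ge0.
    - apply: (@measurable_fun_fubini_tonelli_F _ _ _ _ _ planeM
        (fun p : plane * plane => `|F p|%:E)) => //.
      by apply/measurable_EFinP; exact: measurableT_comp.
    - by apply/measurable_EFinP; apply: measurable_funM => //;
      exact: measurable_ibox.
    - move=> z _; apply: (@le_trans _ _ (\int[planeM]_w
        (K * C * ibox M z * `|g w * ibox (M + 1) w|)%:E)%E).
        apply: ge0_le_integral => //=.
        + apply/measurable_EFinP; apply: measurableT_comp => //.
          exact: (measurable_fun_pair2 z mF).
        + apply/measurable_EFinP; apply: measurable_funM => //.
          exact: (integ_measurable iN).
        + by move=> w _; rewrite lee_fin; exact: Fle.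
      rewrite EFin_pint; last exact: integZ.
      by rewrite pintZ// -/N lee_fin mulrAC.
  rewrite EFin_pint; last exact/integZ/integ_ibox.
  exact: ltry.
have i12 := integral12_prod_meas1 iF.
have i21 := integral21_prod_meas1 iF.
have FE z : fubini_F planeM (EFin \o F) z = (chi z * conv g k z)%:E.
  rewrite /fubini_F /= /F /= EFin_pint; last exact/integZ/conv_integ.
  by rewrite pintZ//; exact: conv_integ.
have ichi w : integ (fun z => chi z * k (z - w)).
  have [] // := @locint_mul _ (fun z => k (z - w)) chi M K _ mchi hK chi0.
    apply: locint_continuous => z; apply: (continuous_comp (f := fun z => z - w)).
      by apply: cvgB; [exact: cvg_id|exact: cvg_cst].
    exact: ck.
  by move=> + _; apply: eq_integ => z; rewrite mulrC.
have GE w : fubini_G planeM (EFin \o F) w =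
    (g w * pint (fun z => chi z * k (z - w)))%:E.
  rewrite /fubini_G /= /F /=.
  under eq_integral do rewrite mulrCA.
  by rewrite EFin_pint; [rewrite pintZ|exact: integZ].
split.
  have mG : measurable_fun setT
      (fun w : plane => g w * pint (fun z => chi z * k (z - w))).
    apply/measurable_EFinP.
    have -> : EFin \o (fun w : plane => g w * pint (fun z => chi z * k (z - w))) =
      fubini_G planeM (EFin \o F) by apply/funext => w; rewrite GE.
    exact: (measurable_fubini_G iF).
  apply: (integ_le (g := fun w => K * C * pint (ibox M) * `|g w * ibox (M + 1)
    w|)).
  - exact: mG.
  - exact: integZ.
  - move=> w; rewrite normrM.
    have [wM|wM] := pselect (box (M + 1) w); last first.
      rewrite (_ : pint _ = 0) ?normr0 ?mulr0.
        by rewrite !mulr_ge0 ?(ltW C0)//; apply: pint_ge0 => p; exact: ibox_ge0.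
      rewrite -[RHS](mul0r (pint (ibox M))) -pintZ; last exact: integ_ibox.
      apply: eq_pint => z; rewrite mul0r.
      have [zM|/chi0 ->] := pselect (box M z); last by rewrite mul0r.
      by rewrite kbox// mulr0.
    rewrite /ibox [in leRHS]indicE [_ \in box (M + 1)]mem_set// mulr1 mulrC
      ler_wpM2r//.
    apply: (le_trans (le_norm_pint (ichi w))).
    rewrite -pintZ; last exact: integ_ibox.
    apply: le_pint; [exact: integ_norm|exact/integZ/integ_ibox|].
    move=> z; have [zM|/chi0 ->] := pselect (box M z); last first.
      by rewrite mul0r normr0 !mulr_ge0 ?(ltW C0) ?ibox_ge0.
    by rewrite /ibox indicE mem_set// mulr1 normrM ler_pM.
have E : (\int[planeM]_z (chi z * conv g k z)%:E =
    \int[planeM]_w (g w * pint (fun z => chi z * k (z - w)))%:E)%E.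
  under eq_integral do rewrite -FE.
  under [RHS]eq_integral do rewrite -GE.
  by rewrite i12 i21.
exact: (congr1 fine E).
Qed.

(** The kernel is nonnegative of mass one, so an average stays as close to [c] as the averaged
    values. Only points above and to the right of [w] contribute. *)
Lemma bkernel_average_le e D chi w (c E : R) : 0 < e <= 1 -> bump_family e D ->
  integ (fun z => chi z * bkernel D 0 0 (z - w)) ->
  (forall z, 0 < z.1 - w.1 < e -> 0 < z.2 - w.2 < e -> `|chi z - c| <= E) ->
  `|pint (fun z => chi z * bkernel D 0 0 (z - w)) - c| <= E.
Proof.
move=> e01 DD ichi hE; have [kk _ _ _] := bkernelP 0 0 e01 DD.
have [_ D0 Dge0 _] := DD.
have i1 : integ (fun z => bkernel D 0 0 (z - w)).
  have [ck [C _ hC] k0] := kk.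
  have ck' : continuous (fun z => bkernel D 0 0 (z - w)).
    move=> z; apply: (continuous_comp (f := fun z => z - w)); last exact: ck.
    by apply: cvgB; [exact: cvg_id|exact: cvg_cst].
  apply: eq_integ ((locint_continuous ck').2 (`|w.1| + `|w.2| + 1)) => z.
  have [zb|zb] := pselect (box (`|w.1| + `|w.2| + 1) z).
    by rewrite /ibox indicE mem_set// mulr1.
  rewrite /ibox indicE memNset// mulr0 k0// => /boxP[/= h1 h2]; apply: zb.
  apply/boxP; have n1 := normr_ge0 w.1; have n2 := normr_ge0 w.2; split.
    have -> : z.1 = w.1 + (z.1 - w.1) by ring.
    by rewrite (le_trans (ler_normD _ _))//; lra.
  have -> : z.2 = w.2 + (z.2 - w.2) by ring.
  by rewrite (le_trans (ler_normD _ _))//; lra.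
have mass := (bkernel_mass w e01 DD).2.
have -> : pint (fun z => chi z * bkernel D 0 0 (z - w)) - c =
    pint (fun z => (chi z - c) * bkernel D 0 0 (z - w)).
  rewrite -[X in _ - X]mulr1 -mass -(pintZ c i1) -(pintB ichi (integZ c i1)).
  by apply: eq_pint => z; rewrite mulrBl.
have i2 : integ (fun z => (chi z - c) * bkernel D 0 0 (z - w)).
  by apply: eq_integ (integB ichi (integZ c i1)) => z; rewrite mulrBl.
apply: (le_trans (le_norm_pint i2)).
rewrite -[leRHS]mulr1 -mass -(pintZ E i1).
apply: le_pint; [exact: integ_norm|exact: integZ|].
move=> z; rewrite normrM [X in _ * X]ger0_norm ?mulr_ge0// /bkernel /=.
have [z1|/D0 ->] := boolP (0 < z.1 - w.1 < e); last by rewrite mul0r !mulr0.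
have [z2|/D0 ->] := boolP (0 < z.2 - w.2 < e); last by rewrite !mulr0.
by rewrite ler_wpM2r ?mulr_ge0// hE.
Qed.

(** By [conv_adjoint] the averages fall on [chi]. They converge pointwise by continuity from the
    upper right, and K |g| on a box one unit larger is an integrable majorant. *)
Lemma mollify_limit g chi M K (D : nat -> nat -> R -> R) : locint g ->
  measurable_fun setT (chi : plane -> R) -> (forall z, `|chi z| <= K) ->
  (forall z, ~ box M z -> chi z = 0) ->
  (forall w e, 0 < e -> exists2 d, 0 < d & forall z,
    0 < z.1 - w.1 < d -> 0 < z.2 - w.2 < d -> `|chi z - chi w| <= e) ->
  (forall n, bump_family n.+1%:R^-1 (D n)) ->
  pint (fun z => chi z * conv g (bkernel (D n) 0 0) z) @[n --> \oo] -->
    pint (fun w => g w * chi w).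
Proof.
move=> gi mchi hK chi0 cchi DD.
have e01 n : 0 < (n.+1%:R : R)^-1 <= 1
  by rewrite invr_gt0 ltr0n/= invf_le1// ler1n.
have kk n : kernel (bkernel (D n) 0 0) by have [] := bkernelP 0 0 (e01 n) (DD n).
pose chin n w := pint (fun z => chi z * bkernel (D n) 0 0 (z - w)).
have adj n := conv_adjoint gi (kk n) mchi hK chi0.
have K0 : 0 <= K by apply: le_trans (hK (0, 0)).
have ichi n w : integ (fun z => chi z * bkernel (D n) 0 0 (z - w)).
  have [ck _ _] := kk n.
  have [] // := @locint_mul _ (fun z => bkernel (D n) 0 0 (z - w)) chi M K _
    mchi hK chi0.
    apply: locint_continuous => z; apply: (continuous_comp (f := fun z => z - w)).
      by apply: cvgB; [exact: cvg_id|exact: cvg_cst].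
    exact: ck.
  by move=> + _; apply: eq_integ => z; rewrite mulrC.
have chinK n w : `|chin n w| <= K.
  (* Compared with the constant 0, the averages inherit the bound of [chi]. *)
  have := @bkernel_average_le _ _ chi w 0 K (e01 n) (DD n) (ichi n w).
  by rewrite subr0; apply=> z _ _; rewrite subr0.
have chin0 n w : ~ box (M + 1) w -> chin n w = 0.
  move=> wM; rewrite /chin -[RHS](mul0r (pint (ibox 1))) -pintZ;
    last exact: integ_ibox.
  apply: eq_pint => z; rewrite mul0r.
  have [/boxP[z1 z2]|/chi0 ->] := pselect (box M z); last by rewrite mul0r.
  have [_ _ ->] := kk n; first by rewrite mulr0.
  move=> /boxP[/= h1 h2]; apply: wM; apply/boxP; split.
    have -> : w.1 = z.1 - (z.1 - w.1) by ring.
    by rewrite (le_trans (ler_normB _ _))// lerD.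
  have -> : w.2 = z.2 - (z.2 - w.2) by ring.
  by rewrite (le_trans (ler_normB _ _))// lerD.
have chin_cvg w : chin n w @[n --> \oo] --> chi w.
  apply/cvgrPdist_le => e e0; have [d d0 hd] := cchi w e e0.
  near=> n; rewrite distrC; apply: (bkernel_average_le (e01 n) (DD n) (ichi n w)).
  have nd : (n.+1%:R : R)^-1 < d by near: n;
    exact: (near_infty_natSinv_lt (PosNum d0)).
  by move=> z /andP[z1 z2] /andP[z3 z4]; apply: hd;
    rewrite ?z1 ?z3 /= (lt_trans _ nd).
have iN : integ (fun w => K * `|g w * ibox (M + 1) w|).
  by apply/integZ/integ_norm; exact: gi.2.
under eq_fun do rewrite (adj _).2.
have igchi : integ (fun w => g w * chi w)
  by have [] := locint_mul gi mchi hK chi0.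
apply: fine_cvg; rewrite fineK; last exact: integrable_fin_num igchi.
apply: (@dominated_cvg _ _ _ planeM setT measurableT
  (fun n (w : plane) => (g w * chin n w)%:E) (fun w : plane => (g w * chi w)%:E)
  (fun w : plane => (K * `|g w * ibox (M + 1) w|)%:E)) => //.
- by move=> n; apply/measurable_EFinP; exact: integ_measurable (adj n).1.
- move=> w _; apply: cvg_EFin; first exact: nearW.
  by apply: cvgM; [exact: cvg_cst|exact: chin_cvg].
- move=> n w _; rewrite /= lee_fin normrM mulrC.
  have [wM|wM] := pselect (box (M + 1) w).
    by rewrite /ibox indicE mem_set// mulr1 ler_wpM2r// chinK.
  by rewrite -/(chin n w) chin0// normr0 mul0r mulr_ge0.
Unshelve. all: by end_near. Qed.

End mollification.

(** * Subharmonic functions *)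

Section subharmonic.
Context {R : realType}.
Local Notation plane := (measurableTypeR R * measurableTypeR R)%type.
Local Notation mu := (@lebesgue_measure R).
Local Notation is_der x f a := (is_derive (x : R) (1 : R) (f : R -> R) (a : R)).
Implicit Types (F G S a b psi : R * R -> R).

Lemma contD F G : continuous F -> continuous G -> continuous (fun p => F p + G p).
Proof. by move=> cF cG p; apply: cvgD; [exact: cF|exact: cG]. Qed.

Lemma contB F G : continuous F -> continuous G -> continuous (fun p => F p - G p).
Proof. by move=> cF cG p; apply: cvgB; [exact: cF|exact: cG]. Qed.

Lemma contM F G : continuous F -> continuous G -> continuous (fun p => F p * G p).
Proof. by move=> cF cG p; apply: cvgM; [exact: cF|exact: cG]. Qed.

Lemma contC (k : R) : continuous (fun _ : R * R => k).
Proof. by move=> p; exact: cvg_cst. Qed.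

Lemma contX F n : continuous F -> continuous (fun p => F p ^+ n).
Proof.
move=> cF; elim: n => [|n IH]; first by under eq_fun do rewrite expr0;
  exact: contC.
by under eq_fun do rewrite exprS; exact: contM.
Qed.

Lemma cont_comp (f : R -> R) F : continuous f -> continuous F ->
  continuous (fun p => f (F p)).
Proof. by move=> cf cF p; apply: continuous_comp; [exact: cF|exact: cf]. Qed.

Lemma cont_fst : continuous (fun p : R * R => p.1).
Proof. by move=> p; exact: cvg_fst. Qed.

Lemma cont_snd : continuous (fun p : R * R => p.2).
Proof. by move=> p; exact: cvg_snd. Qed.

Lemma cont_pair1 (y : R) : continuous (fun x : R => (x, y)).
Proof.
move=> x A [[B C]] /= [Bx Cy] BC; apply: filterS Bx => t Bt; apply: BC;
  split=> //.
exact: nbhs_singleton Cy.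
Qed.

Lemma cont_pair2 (x : R) : continuous (fun y : R => (x, y)).
Proof.
move=> y A [[B C]] /= [Bx Cy] BC; apply: filterS Cy => t Bt; apply: BC;
  split=> //.
exact: nbhs_singleton Bx.
Qed.

(* Mixed derivatives are left out: the Laplacian only involves the pure ones. *)
Record C2 F Fx Fxx Fy Fyy : Prop := {
  C2_cont : continuous F;
  C2_contx : continuous Fx;
  C2_contxx : continuous Fxx;
  C2_conty : continuous Fy;
  C2_contyy : continuous Fyy;
  C2_dx : forall x y, is_der x (fun t => F (t, y)) (Fx (x, y));
  C2_dxx : forall x y, is_der x (fun t => Fx (t, y)) (Fxx (x, y));
  C2_dy : forall x y, is_der y (fun t => F (x, t)) (Fy (x, y));
  C2_dyy : forall x y, is_der y (fun t => Fy (x, t)) (Fyy (x, y)) }.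

Lemma integral_derivative_compact (f F : R -> R) (M : R) : 0 < M ->
  continuous f -> (forall x, is_der x F (f x)) ->
  (forall x, M <= `|x| -> F x = 0 /\ f x = 0) -> (\int[mu]_x (f x)%:E = 0)%E.
Proof.
move=> M0 cf dF z; transitivity (\int[mu]_(x in `[(- M)%R, M]) (f x)%:E)%E.
  rewrite [RHS]integral_mkcond/=; apply: eq_integral => x _.
  rewrite patchE; case: ifPn => // xM; rewrite (z x _).2//.
  rewrite leNgt; apply: contra xM => xM; rewrite inE /= in_itv/= -ler_norml.
  exact: ltW.
rewrite (@continuous_FTC2 _ f F).
- have nM : M <= `|M| by exact: ler_norm.
  have nNM : M <= `|- M| by rewrite normrN.
  by rewrite (z M nM).1 (z _ nNM).1 subee.
- by rewrite (lt_trans _ M0)// oppr_lt0.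
- exact: continuous_subspaceT.
- split.
  + by move=> t _; exact: der_derivable (dF t).
  + by apply: cvg_at_right_filter; exact: der_continuous (dF _).
  + by apply: cvg_at_left_filter; exact: der_continuous (dF _).
- by move=> t _; exact: der_derive1 (dF t).
Qed.

Definition off_box (M : R) F := forall p, M <= `|p.1| \/ M <= `|p.2| -> F p = 0.

Lemma off_box_integ M F : continuous F -> off_box M F -> integ F.
Proof.
move=> cF F0; apply: eq_integ ((locint_continuous cF).2 M) => p.
have [pM|pM] := pselect (box M p); first by rewrite /ibox indicE mem_set// mulr1.
rewrite /ibox indicE memNset// mulr0 F0//; apply/orP;
  rewrite -[_ || _]negbK negb_or.
by apply/negP => /andP[h1 h2]; apply: pM; apply/boxP; split; rewrite ltW// ltNge.
Qed.

(** The integrand is the x-derivative of G Sx - Gx S, which has compact support, so its integral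
    along every horizontal line is zero. *)
Lemma green_x M G Gx Gxx Gy Gyy S Sx Sxx Sy Syy : 0 < M ->
  C2 G Gx Gxx Gy Gyy -> C2 S Sx Sxx Sy Syy ->
  off_box M G -> off_box M Gx -> off_box M Gxx ->
  pint (fun p => G p * Sxx p - Gxx p * S p) = 0.
Proof.
move=> M0 cG cS G0 Gx0 Gxx0; set f := (fun p => _).
have cf : continuous f.
  by apply: contB; apply: contM; [exact: C2_cont cG|exact: C2_contxx cS|
    exact: C2_contxx cG|exact: C2_cont cS].
have fi : integ f.
  by apply: (@off_box_integ M) => // p pM; rewrite /f G0// Gxx0// !mul0r subrr.
have := integral21_prod_meas1 fi; rewrite /pint /Rintegral /planeM => <-.
rewrite (_ : (\int[mu]_x _)%E = 0%E)//; apply: integral0_eq => y _.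
rewrite /fubini_G /=.
apply: (@integral_derivative_compact _
  (fun x => G (x, y) * Sx (x, y) - Gx (x, y) * S (x, y)) M) => //.
- move=> x; apply: (continuous_comp (f := fun x => (x, y))); last exact: cf.
  exact: cont_pair1.
- move=> x; apply: is_derive_eq (derB (derM (C2_dx cG x y) (C2_dxx cS x y))
    (derM (C2_dxx cG x y) (C2_dx cS x y))) _.
  by rewrite /f; ring.
- move=> x xM; rewrite /f G0; last by left.
  by rewrite Gx0; [rewrite Gxx0; [rewrite !mul0r subrr|left]|left].
Qed.

Lemma green_y M G Gx Gxx Gy Gyy S Sx Sxx Sy Syy : 0 < M ->
  C2 G Gx Gxx Gy Gyy -> C2 S Sx Sxx Sy Syy ->
  off_box M G -> off_box M Gy -> off_box M Gyy ->
  pint (fun p => G p * Syy p - Gyy p * S p) = 0.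
Proof.
move=> M0 cG cS G0 Gy0 Gyy0; set f := (fun p => _).
have cf : continuous f.
  by apply: contB; apply: contM; [exact: C2_cont cG|exact: C2_contyy cS|
    exact: C2_contyy cG|exact: C2_cont cS].
have fi : integ f.
  by apply: (@off_box_integ M) => // p pM; rewrite /f G0// Gyy0// !mul0r subrr.
have := integral12_prod_meas1 fi; rewrite /pint /Rintegral /planeM => <-.
rewrite (_ : (\int[mu]_x _)%E = 0%E)//; apply: integral0_eq => x _.
rewrite /fubini_F /=.
apply: (@integral_derivative_compact _
  (fun y => G (x, y) * Sy (x, y) - Gy (x, y) * S (x, y)) M) => //.
- move=> y; apply: (continuous_comp (f := fun y => (x, y))); last exact: cf.
  exact: cont_pair2.
- move=> y; apply: is_derive_eq (derB (derM (C2_dy cG x y) (C2_dyy cS x y))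
    (derM (C2_dyy cG x y) (C2_dy cS x y))) _.
  by rewrite /f; ring.
- move=> y yM; rewrite /f G0; last by right.
  by rewrite Gy0; [rewrite Gyy0; [rewrite !mul0r subrr|right]|right].
Qed.

Definition pos (t : R) : R := Num.max t 0.

Lemma pos_ge0 t : 0 <= pos t. Proof. by rewrite /pos le_max lexx orbT. Qed.

Lemma posP t : (0 <= t /\ pos t = t) \/ (t <= 0 /\ pos t = 0).
Proof.
by rewrite /pos; case: (leP t 0) => h; [right|left; split=> //; exact: ltW].
Qed.

Lemma continuous_pos : continuous pos.
Proof.
move=> t; apply: (@continuous_max _ _ id (fun=> 0)); first exact: cvg_id.
exact: cvg_cst.
Qed.

Lemma der_pos2 t : is_der t (fun s => pos s ^+ 2) (2 * pos t).
Proof.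
apply: (@der_quadratic _ _ _ _ 1) => s _; rewrite mul1r ler_norml.
have d2 := sqr_ge0 (s - t); have s2 := sqr_ge0 s; have t2 := sqr_ge0 t.
have [[hs ->]|[hs ->]] := posP s; have [[ht ->]|[ht ->]] := posP t.
- by rewrite (_ : s ^+ 2 - _ - _ = (s - t) ^+ 2); [apply/andP; split; lra|ring].
- have st : 0 <= s * - t by rewrite mulr_ge0// oppr_ge0.
  by apply/andP; split; nra.
- have st : 0 <= t * - s by rewrite mulr_ge0// oppr_ge0.
  by apply/andP; split; nra.
- by apply/andP; split; lra.
Qed.

Lemma der_pos3 t : is_der t (fun s => pos s ^+ 3) (3 * pos t ^+ 2).
Proof.
(* For s, t >= 0 the remainder is (s + 2 t) (s - t)^2, and s <= t + 1. For opposite signs both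
   numbers are within |s - t| <= 1 of 0, and the remainder is at most 3 (s - t)^2. *)
apply: (@der_quadratic _ _ _ _ (3 * pos t + 3)) => s;
  rewrite ler_norml => /andP[h1 h2].
rewrite ler_norml; have d2 := sqr_ge0 (s - t).
have [[hs ->]|[hs ->]] := posP s; have [[ht ->]|[ht ->]] := posP t.
- rewrite (_ : s ^+ 3 - _ - _ = (s + 2 * t) * (s - t) ^+ 2); last by ring.
  by rewrite -mulNr; apply/andP; split; rewrite ler_wpM2r//; lra.
- rewrite !expr0n/= !(mulr0, mul0r, subr0, add0r).
  have s3 : 0 <= s ^+ 3 by rewrite exprn_ge0.
  have s2 : s ^+ 3 <= 1 * s ^+ 2 by rewrite exprS ler_wpM2r ?sqr_ge0//; lra.
  have s2d : s ^+ 2 <= (s - t) ^+ 2 by rewrite lerXn2r ?nnegrE//; lra.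
  by apply/andP; split; lra.
- rewrite expr0n/= sub0r (_ : - _ - _ = t ^+ 2 * (2 * t - 3 * s)); last by ring.
  have e0 : 0 <= t ^+ 2 * (2 * t - 3 * s) by rewrite mulr_ge0 ?sqr_ge0//; lra.
  have e1 : t ^+ 2 * (2 * t - 3 * s) <= t ^+ 2 * 3
    by rewrite ler_wpM2l ?sqr_ge0//; lra.
  have t2d : t ^+ 2 <= (s - t) ^+ 2.
    by rewrite -[leRHS]sqrrN opprB lerXn2r ?nnegrE//; lra.
  have td0 : 0 <= t * (s - t) ^+ 2 by rewrite mulr_ge0.
  by apply/andP; split; rewrite mulrDl; lra.
- rewrite !expr0n/= !(mulr0, mul0r, subr0, add0r).
  by apply/andP; split; lra.
Qed.

Definition sqnorm2 (p : R * R) : R := p.1 ^+ 2 + p.2 ^+ 2.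

Lemma continuous_sqnorm2 : continuous sqnorm2.
Proof.
by apply: contD; apply: contX; [exact: cont_fst|exact: cont_snd].
Qed.

(** * The cutoff (L - |p|^2)_+^3 and its Laplacian *)

Section cutoff.
Variable L : R.
Hypothesis L1 : 1 <= L.
Let q (p : R * R) := pos (L - sqnorm2 p).

(** Three is the least integer exponent for which the second derivatives are continuous across the
    circle |p|^2 = L. *)
Definition cutoff p := q p ^+ 3.
Definition cutoffx p := - 6 * (p.1 * q p ^+ 2).
Definition cutoffxx p := - 6 * q p ^+ 2 + 24 * (p.1 ^+ 2 * q p).
Definition cutoffy p := - 6 * (p.2 * q p ^+ 2).
Definition cutoffyy p := - 6 * q p ^+ 2 + 24 * (p.2 ^+ 2 * q p).

Let cq : continuous q.
Proof.
apply: cont_comp; first exact: continuous_pos.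
by apply: contB; [exact: contC|exact: continuous_sqnorm2].
Qed.

Lemma cutoff_C2 : C2 cutoff cutoffx cutoffxx cutoffy cutoffyy.
Proof.
have dx x y : is_der x (fun t => L - sqnorm2 (t, y)) (- (2 * x)).
  apply: is_derive_eq (derB (derC L x) (derD (derX 2 (der_id x)) (derC (y ^+ 2)
    x))) _.
  by rewrite /=; ring.
have dy x y : is_der y (fun t => L - sqnorm2 (x, t)) (- (2 * y)).
  apply: is_derive_eq (derB (derC L y) (derD (derC (x ^+ 2) y) (derX 2 (der_id
    y)))) _.
  by rewrite /=; ring.
split.
- exact: contX.
- apply: contM; first exact: contC.
  by apply: contM; [exact: cont_fst|exact: contX].
- apply: contD; apply: contM; [exact: contC|exact: contX|exact: contC|].
  by apply: contM => //; apply: contX; exact: cont_fst.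
- apply: contM; first exact: contC.
  by apply: contM; [exact: cont_snd|exact: contX].
- apply: contD; apply: contM; [exact: contC|exact: contX|exact: contC|].
  by apply: contM => //; apply: contX; exact: cont_snd.
- move=> x y; apply: is_derive_eq (der_comp (dx x y) (der_pos3 _)) _.
  by rewrite /cutoffx /q /=; ring.
- move=> x y; apply: is_derive_eq (derZ (- 6) (derM (der_id x)
    (der_comp (dx x y) (der_pos2 _)))) _.
  by rewrite /cutoffxx /q /=; ring.
- move=> x y; apply: is_derive_eq (der_comp (dy x y) (der_pos3 _)) _.
  by rewrite /cutoffy /q /=; ring.
- move=> x y; apply: is_derive_eq (derZ (- 6) (derM (der_id y)
    (der_comp (dy x y) (der_pos2 _)))) _.
  by rewrite /cutoffyy /q /=; ring.
Qed.

(** Since L >= 1, L^2 >= L; the square of half-side L thus contains the disc |p|^2 < L that carries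
    the cutoff. *)
Lemma sqnorm2_off_box p : L <= `|p.1| \/ L <= `|p.2| -> L <= sqnorm2 p.
Proof.
have L0 : 0 <= L by exact: le_trans L1.
have L2 : L <= L ^+ 2 by rewrite expr2 ler_peMl.
rewrite /sqnorm2 => -[h|h]; apply: (le_trans L2).
  rewrite -[X in _ <= X + _]real_normK ?num_real// -[leLHS]addr0.
  by rewrite lerD ?sqr_ge0// lerXn2r ?nnegrE.
rewrite -[X in _ <= _ + X]real_normK ?num_real// -[leLHS]add0r.
by rewrite lerD ?sqr_ge0// lerXn2r ?nnegrE.
Qed.

Let q0 p : L <= sqnorm2 p -> q p = 0.
Proof. by move=> h; rewrite /q;
  have [[? ->]|[_ ->]] := posP (L - sqnorm2 p) => //; lra. Qed.

(* The negative and positive parts of the Laplacian of the cutoff, up to a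
   factor 12: kappa1 lives on |p|^2 <= L / 3 and kappa2 on |p|^2 >= L / 3. *)
Definition kappa1 p := q p * pos (L - 3 * sqnorm2 p).
Definition kappa2 p := q p * pos (3 * sqnorm2 p - L).

Lemma continuous_kappa2 : continuous kappa2.
Proof.
apply: contM => //; apply: cont_comp; first exact: continuous_pos.
apply: contB; last exact: contC.
by apply: contM; [exact: contC|exact: continuous_sqnorm2].
Qed.

Lemma continuous_kappa1 : continuous kappa1.
Proof.
apply: contM => //; apply: cont_comp; first exact: continuous_pos.
apply: contB; first exact: contC.
by apply: contM; [exact: contC|exact: continuous_sqnorm2].
Qed.

Lemma off_box_kappa1 : off_box L kappa1.
Proof. by move=> p /sqnorm2_off_box/q0; rewrite /kappa1 => ->; rewrite mul0r. Qed.

Lemma off_box_kappa2 : off_box L kappa2.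
Proof. by move=> p /sqnorm2_off_box/q0; rewrite /kappa2 => ->; rewrite mul0r. Qed.

Lemma kappa_ge0 p : 0 <= kappa1 p /\ 0 <= kappa2 p.
Proof. by rewrite !mulr_ge0 ?pos_ge0. Qed.

(** The sum is 12 q (2 |p|^2 - q), and the last factor is 3 |p|^2 - L wherever q > 0. *)
Lemma cutoff_laplacian p : cutoffxx p + cutoffyy p = 12 * (kappa2 p - kappa1 p).
Proof.
rewrite /cutoffxx /cutoffyy /kappa1 /kappa2 -mulrBr.
rewrite (_ : pos (3 * sqnorm2 p - L) - _ = 3 * sqnorm2 p - L); last first.
  have [[? ->]|[? ->]] := posP (3 * sqnorm2 p - L);
    by have [[? ->]|[? ->]] := posP (L - 3 * sqnorm2 p); lra.
rewrite /q; have [[_ ->]|[_ ->]] := posP (L - sqnorm2 p); rewrite /sqnorm2; ring.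
Qed.

Lemma subharmonic_kappa S Sx Sxx Sy Syy : C2 S Sx Sxx Sy Syy ->
  (forall p, 0 <= Sxx p + Syy p) ->
  pint (fun p => S p * kappa1 p) <= pint (fun p => S p * kappa2 p).
Proof.
move=> cS sub; have L0 : 0 < L by exact: lt_le_trans L1.
have G0 : off_box L cutoff by move=> p /sqnorm2_off_box/q0;
  rewrite /cutoff => ->; rewrite expr0n.
have Gx0 : off_box L cutoffx.
  by move=> p /sqnorm2_off_box/q0; rewrite /cutoffx => ->;
    rewrite expr0n/= !mulr0.
have Gy0 : off_box L cutoffy.
  by move=> p /sqnorm2_off_box/q0; rewrite /cutoffy => ->;
    rewrite expr0n/= !mulr0.
have Gxx0 : off_box L cutoffxx.
  by move=> p /sqnorm2_off_box/q0; rewrite /cutoffxx => ->;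
    rewrite expr0n/= !mulr0 addr0.
have Gyy0 : off_box L cutoffyy.
  by move=> p /sqnorm2_off_box/q0; rewrite /cutoffyy => ->;
    rewrite expr0n/= !mulr0 addr0.
have gx := green_x L0 cutoff_C2 cS G0 Gx0 Gxx0.
have gy := green_y L0 cutoff_C2 cS G0 Gy0 Gyy0.
have cSS := C2_cont cS; have cG := C2_cont cutoff_C2.
have ioff F H : continuous F -> continuous H -> off_box L H -> integ (fun p => H
  p * F p).
  move=> cF cH H0; apply: (@off_box_integ L); first exact: contM.
  by move=> p /H0 ->; rewrite mul0r.
have i1 := ioff _ _ (C2_contxx cS) cG G0;
  have i2 := ioff _ _ (C2_contyy cS) cG G0.
have i3 := ioff _ _ cSS (C2_contxx cutoff_C2) Gxx0.
have i4 := ioff _ _ cSS (C2_contyy cutoff_C2) Gyy0.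
have k1 := ioff _ _ cSS continuous_kappa1 off_box_kappa1.
have k2 := ioff _ _ cSS continuous_kappa2 off_box_kappa2.
have : 0 <= pint (fun p => cutoff p * Sxx p) + pint (fun p => cutoff p * Syy p).
  rewrite -(pintD i1 i2); apply: pint_ge0 => p.
  by rewrite -mulrDr mulr_ge0// /cutoff exprn_ge0// pos_ge0.
move: gx gy; rewrite (pintB i1 i3) (pintB i2 i4) => gx gy.
(* Green's formula in each variable moves the Laplacian from [S] to the cutoff. *)
have -> : pint (fun p => cutoff p * Sxx p) + pint (fun p => cutoff p * Syy p) =
    pint (fun p => cutoffxx p * S p) + pint (fun p => cutoffyy p * S p) by lra.
rewrite -(pintD i3 i4).
rewrite (@eq_pint _ _ (fun p => 12 * (kappa2 p * S p - kappa1 p * S p)));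
  last first.
  by move=> p; rewrite -mulrDl cutoff_laplacian -mulrA mulrBl.
rewrite (pintZ _ (integB k2 k1)) (pintB k2 k1) pmulr_rge0// subr_ge0.
rewrite (@eq_pint _ _ (fun p => S p * kappa1 p)); last by move=> p; rewrite mulrC.
by rewrite (@eq_pint _ (fun p => kappa2 p * S p) (fun p => S p * kappa2 p))// =>
  p; rewrite mulrC.
Qed.

End cutoff.

End subharmonic.

(** * The square modulus of a holomorphic function times exp psi *)

Section weighted_norm.
Context {R : realType}.
Local Notation is_der x f a := (is_derive (x : R) (1 : R) (f : R -> R) (a : R)).

Lemma der_weighted (a b psi a1 b1 psi1 : R -> R) (a2 b2 psi2 t : R) :
  is_der t a (a1 t) -> is_der t b (b1 t) -> is_der t psi (psi1 t) ->
  is_der t a1 a2 -> is_der t b1 b2 -> is_der t psi1 psi2 ->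
  is_der t (fun s => (a s ^+ 2 + b s ^+ 2) * expR (psi s))
    ((2 * (a t * a1 t + b t * b1 t) + (a t ^+ 2 + b t ^+ 2) * psi1 t) *
      expR (psi t)) /\
  is_der t (fun s => (2 * (a s * a1 s + b s * b1 s) +
      (a s ^+ 2 + b s ^+ 2) * psi1 s) * expR (psi s))
    ((2 * (a1 t ^+ 2 + a t * a2 + b1 t ^+ 2 + b t * b2) +
      4 * (a t * a1 t + b t * b1 t) * psi1 t +
      (a t ^+ 2 + b t ^+ 2) * (psi1 t ^+ 2 + psi2)) * expR (psi t)).
Proof.
move=> da db dp da1 db1 dp1; split.
  apply: is_derive_eq (derM (derD (derX 2 da) (derX 2 db)) (der_expR dp)) _.
  by rewrite /=; ring.
apply: is_derive_eq (derM (derD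
  (derZ 2 (derD (derM da da1) (derM db db1)))
  (derM (derD (derX 2 da) (derX 2 db)) dp1)) (der_expR dp)) _.
by rewrite /=; ring.
Qed.

Implicit Types a b psi : R * R -> R.

Definition wnorm a b psi p : R := (a p ^+ 2 + b p ^+ 2) * expR (psi p).
Definition wnorm1 a a1 b b1 psi psi1 (p : R * R) : R :=
  (2 * (a p * a1 p + b p * b1 p) + (a p ^+ 2 + b p ^+ 2) * psi1 p) *
  expR (psi p).
Definition wnorm2 a a1 a2 b b1 b2 psi psi1 psi2 (p : R * R) : R :=
  (2 * (a1 p ^+ 2 + a p * a2 p + b1 p ^+ 2 + b p * b2 p) +
   4 * (a p * a1 p + b p * b1 p) * psi1 p +
   (a p ^+ 2 + b p ^+ 2) * (psi1 p ^+ 2 + psi2 p)) * expR (psi p).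

Lemma cont_expR : continuous (@expR R).
Proof. exact: continuous_expR. Qed.

Lemma wnorm_C2 a ax axx ay ayy b bx bxx by_ byy psi px pxx py pyy :
  C2 a ax axx ay ayy -> C2 b bx bxx by_ byy -> C2 psi px pxx py pyy ->
  C2 (wnorm a b psi) (wnorm1 a ax b bx psi px)
     (wnorm2 a ax axx b bx bxx psi px pxx)
     (wnorm1 a ay b by_ psi py) (wnorm2 a ay ayy b by_ byy psi py pyy).
Proof.
case=> ca cax caxx cay cayy da dax day dayy.
case=> cb cbx cbxx cby cbyy db dbx dby dbyy.
case=> cp cpx cpxx cpy cpyy dp dpx dpy dpyy.
have ce : continuous (fun p => expR (psi p)) by apply: cont_comp => //;
  exact: cont_expR.
have cn : continuous (fun p => a p ^+ 2 + b p ^+ 2) by apply: contD; exact: contX.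
have c1 a1 b1 p1 : continuous a1 -> continuous b1 -> continuous p1 ->
    continuous (wnorm1 a a1 b b1 psi p1).
  move=> ca1 cb1 cp1; apply: contM => //; apply: contD; last exact: contM.
  by apply: contM; [exact: contC|apply: contD; exact: contM].
have c2 a1 a2 b1 b2 p1 p2 : continuous a1 -> continuous a2 -> continuous b1 ->
    continuous b2 -> continuous p1 -> continuous p2 ->
    continuous (wnorm2 a a1 a2 b b1 b2 psi p1 p2).
  move=> ca1 ca2 cb1 cb2 cp1 cp2; apply: contM => //; apply: contD.
    apply: contD.
      apply: contM; first exact: contC.
      by apply: contD; [apply: contD; [apply: contD|]|];
        try exact: contX; exact: contM.
    apply: contM => //; apply: contM; first exact: contC.
    by apply: contD; exact: contM.
  by apply: contM => //; apply: contD => //; exact: contX.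
split.
- exact: contM.
- exact: c1.
- exact: c2.
- exact: c1.
- exact: c2.
- by move=> x y; have [] := der_weighted (da x y) (db x y) (dp x y) (dax x y)
  (dbx x y) (dpx x y).
- by move=> x y; have [] := der_weighted (da x y) (db x y) (dp x y) (dax x y)
  (dbx x y) (dpx x y).
- by move=> x y; have [] := der_weighted (day x y) (dby x y) (dpy x y) (dayy x
  y) (dbyy x y) (dpyy x y).
- by move=> x y; have [] := der_weighted (day x y) (dby x y) (dpy x y) (dayy x
  y) (dbyy x y) (dpyy x y).
Qed.

(* With h = a + i b holomorphic, the Laplacian of |h|^2 exp psi is
   |2 h' + 2 h psi_z|^2 exp psi + |h|^2 (psi_xx + psi_yy) exp psi. *)
Lemma wnorm_subharmonic a ax axx ay ayy b bx bxx by_ byy psi px pxx py pyy p :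
  ax p = by_ p -> ay p = - bx p -> axx p + ayy p = 0 -> bxx p + byy p = 0 ->
  0 <= pxx p + pyy p ->
  0 <= wnorm2 a ax axx b bx bxx psi px pxx p +
       wnorm2 a ay ayy b by_ byy psi py pyy p.
Proof.
move=> cr1 cr2 la lb lp.
rewrite /wnorm2 -mulrDl mulr_ge0 ?expR_ge0//.
have -> : ayy p = - axx p by lra.
have -> : byy p = - bxx p by lra.
rewrite cr2 -cr1.
set X := (X in 0 <= X).
have -> : X = (2 * ax p + a p * px p + b p * py p) ^+ 2 +
  (2 * bx p + b p * px p - a p * py p) ^+ 2 +
  (a p ^+ 2 + b p ^+ 2) * (pxx p + pyy p) by rewrite /X; ring.
by rewrite !addr_ge0 ?sqr_ge0// mulr_ge0// addr_ge0// sqr_ge0.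
Qed.

End weighted_norm.

(** * Functions with vanishing integral on all rectangles *)

Section density.
Context d (T : measurableType d) {R : realType} (m : {measure set T -> \bar R}).
Variable f : T -> \bar R.
Hypothesis mf : measurable_fun setT f.
Hypothesis f0 : forall x, (0 <= f x)%E.

(** The two proofs are arguments so that the measure structure declared below, which relies on them,
    can be inferred from the term. *)
Definition density of measurable_fun setT f & (forall x, (0 <= f x)%E) :=
  fun A => (\int[m]_(x in A) f x)%E.

Local Notation nu := (density mf f0).

Let nu0 : nu set0 = 0%E. Proof. by rewrite /nu integral_set0. Qed.

Let nu_ge0 A : (0 <= nu A)%E. Proof. exact: integral_ge0. Qed.

Let nu_sigma : semi_sigma_additive nu.
Proof. exact: semi_sigma_additive_nng_induced. Qed.

HB.instance Definition _ := isMeasure.Build _ _ _ nu nu0 nu_ge0 nu_sigma.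

End density.

(** * Half-open rectangles determine a locally integrable function *)

Section rectangles.
Context {R : realType}.
Local Notation plane := (measurableTypeR R * measurableTypeR R)%type.

(** Half-open so that the family is stable under intersection and the indicators are continuous from
    the upper right, as [mollify_limit] demands. *)
Definition rect (x1 x2 y1 y2 : R) : set (R * R) := `[x1, x2[ `*` `[y1, y2[.

Definition rects : set (set plane) :=
  [set A | exists x1 x2 y1 y2, A = rect x1 x2 y1 y2].

Lemma measurable_rect x1 x2 y1 y2 : measurable (rect x1 x2 y1 y2 : set plane).
Proof. by apply: measurableX; exact: measurable_itv. Qed.

Lemma rectP x1 x2 y1 y2 (p : R * R) :
  rect x1 x2 y1 y2 p <-> x1 <= p.1 < x2 /\ y1 <= p.2 < y2.
Proof. by rewrite /rect /= !in_itv. Qed.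

Lemma rects_setI : setI_closed rects.
Proof.
move=> _ _ [a1 [a2 [b1 [b2 ->]]]] [c1 [c2 [d1 [d2 ->]]]].
exists (Num.max a1 c1), (Num.min a2 c2), (Num.max b1 d1), (Num.min b2 d2).
apply/seteqP; split=> p.
  move=> [/rectP[/andP[? ?] /andP[? ?]] /rectP[/andP[? ?] /andP[? ?]]].
  by apply/rectP; rewrite !ge_max !lt_min; split; apply/andP; split; apply/andP;
    split.
move=> /rectP; rewrite !ge_max !lt_min.
move=> [/andP[/andP[? ?] /andP[? ?]] /andP[/andP[? ?] /andP[? ?]]].
by split; apply/rectP; split; apply/andP; split.
Qed.

Lemma bigcup_rect : \bigcup_n rect (- n%:R) n%:R (- n%:R) n%:R = setT.
Proof.
rewrite -subTset => p _; exists (Num.trunc (`|p.1| + `|p.2|)).+1 => //.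
have hn : `|p.1| + `|p.2| < (Num.trunc (`|p.1| + `|p.2|)).+1%:R
  by exact: truncnS_gt.
have n1 := normr_ge0 p.1; have n2 := normr_ge0 p.2.
apply/rectP; split.
  have : `|p.1| < (Num.trunc (`|p.1| + `|p.2|)).+1%:R by lra.
  by rewrite ltr_norml => /andP[/ltW -> ->].
have : `|p.2| < (Num.trunc (`|p.1| + `|p.2|)).+1%:R by lra.
by rewrite ltr_norml => /andP[/ltW -> ->].
Qed.

(** Closed half-planes bounded below in one coordinate are countable unions of rectangles, so both
    coordinates are measurable for the generated sigma-algebra. *)
Lemma measurable_planeE : @measurable _ plane = <<s rects >>.
Proof.
apply/seteqP; split; last first.
  apply: smallest_sub; first exact: sigma_algebra_measurable.
  by move=> _ [x1 [x2 [y1 [y2 ->]]]]; exact: measurable_rect.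
pose T' := g_sigma_algebraType rects.
have m1 : measurable_fun setT (fst : T' -> measurableTypeR R).
  apply: (measurability _ (RGenCInfty.measurableE R)).
  move=> _ [_ [x ->] <-]; rewrite setTI.
  have -> : fst @^-1` `[x, +oo[ =
      \bigcup_n (rect x n%:R (- n%:R) n%:R : set T').
    apply/seteqP; split=> p; rewrite /= in_itv/= andbT; last first.
      by move=> [n _ /rectP[/andP[]]].
    have : [set: plane] p by []. 
    rewrite -bigcup_rect => -[n _ /rectP[/andP[_ h] h2]] xp; exists n => //.
    by apply/rectP; rewrite xp h.
  apply: bigcupT_measurable => n; apply: sub_sigma_algebra.
  by exists x, n%:R, (- n%:R), n%:R.
have m2 : measurable_fun setT (snd : T' -> measurableTypeR R).
  apply: (measurability _ (RGenCInfty.measurableE R)).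
  move=> _ [_ [x ->] <-]; rewrite setTI.
  have -> : snd @^-1` `[x, +oo[ =
      \bigcup_n (rect (- n%:R) n%:R x n%:R : set T').
    apply/seteqP; split=> p; rewrite /= in_itv/= andbT; last first.
      by move=> [n _ /rectP[_ /andP[]]].
    have : [set: plane] p by [].
    rewrite -bigcup_rect => -[n _ /rectP[h2 /andP[_ h]]] xp; exists n => //.
    by apply/rectP; rewrite xp h.
  apply: bigcupT_measurable => n; apply: sub_sigma_algebra.
  by exists (- n%:R), n%:R, x, n%:R.
rewrite measurable_prod_measurableType; apply: smallest_sub.
  exact: smallest_sigma_algebra.
move=> _ [A mA [B mB <-]].
rewrite (_ : A `*` B = (fst @^-1` A) `&` (snd @^-1` B)); last by apply/seteqP;
  split.
have := @measurableI _ T' (fst @^-1` A) (snd @^-1` B); apply.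
  by rewrite -[X in measurable X]setTI; exact: m1.
by rewrite -[X in measurable X]setTI; exact: m2.
Qed.

(** The positive and negative parts of [a] are densities of two measures that agree on rectangles,
    hence on all measurable sets. Where a > 0 the second one vanishes, so the first does too, and
    symmetrically where a < 0. *)
Lemma rect_integral0_ae (a : R * R -> R) : locint a ->
  (forall x1 x2 y1 y2, pint (fun p => a p * \1_(rect x1 x2 y1 y2) p) = 0) ->
  {ae planeM, forall p : plane, a p = 0}.
Proof.
move=> ai a0; have ma := ai.1.
pose f : plane -> \bar R := EFin \o a.
have mf : measurable_fun setT f by exact/measurable_EFinP.
have mp := measurable_funepos mf; have mn := measurable_funeneg mf.
have ge0p x : (0 <= f^\+ x)%E by exact: funepos_ge0.
have ge0n x : (0 <= f^\- x)%E by exact: funeneg_ge0.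
pose mup := density planeM mp ge0p; pose mun := density planeM mn ge0n.
have frect A : rects A -> [/\ mup A = mun A & (mup A < +oo)%E].
  move=> [x1 [x2 [y1 [y2 AE]]]].
  have mA : measurable A by rewrite AE; exact: measurable_rect.
  have ia : integ (fun p => a p * \1_A p).
    pose M := `|x1| + `|x2| + `|y1| + `|y2|.
    have [] // := @locint_mul _ a \1_A M 1 ai.
    - by move=> p; rewrite indicE; case: (_ \in _); rewrite ?normr1 ?normr0.
    - move=> p; rewrite AE => pM; rewrite indicE memNset// => /rectP[h1 h2].
      apply: pM; apply/boxP; move: h1 h2 => /andP[h1 h2] /andP[h3 h4].
      have n1 := ler_norm x2; have n2 := ler_norm (- x1); rewrite normrN in n2.
      have n3 := ler_norm y2; have n4 := ler_norm (- y1); rewrite normrN in n4.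
      have := normr_ge0 x1; have := normr_ge0 x2; have := normr_ge0 y1.
      have := normr_ge0 y2.
      by rewrite /M !ler_norml; split; apply/andP; split; lra.
  have iA : planeM.-integrable A f.
    rewrite -[A]setTI; apply/integrable_restrict => //.
    apply: eq_integrable ia => // p _; rewrite /f patchE /= indicE.
    by case: (p \in A); rewrite ?mulr1 ?mulr0.
  have fp : mup A \is a fin_num.
    by apply: integrable_fin_num => //; exact: integrable_funepos.
  have fn : mun A \is a fin_num.
    by apply: integrable_fin_num => //; exact: integrable_funeneg.
  split; last by rewrite ltey_eq fp.
  have E : (mup A - mun A = 0)%E.
    have -> : (mup A - mun A = \int[planeM]_(p in A) f p)%E.
      by rewrite [RHS]integralE.
    rewrite integral_mkcond (eq_integral (fun p : plane => (a p * \1_A p)%:E)).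
      by rewrite EFin_pint// AE a0.
    by move=> p _; rewrite /f patchE /= indicE; case: (p \in A);
      rewrite ?mulr1 ?mulr0.
  rewrite -(fineK fp) -(fineK fn); congr EFin; apply/eqP; rewrite -subr_eq0.
  by move: E; rewrite -{1}(fineK fp) -{1}(fineK fn) -EFinB => -[->].
have mE A : measurable A -> mup A = mun A.
  apply: (measure_unique rects (fun n => rect (- n%:R) n%:R (- n%:R) n%:R)).
  - exact: measurable_planeE.
  - exact: rects_setI.
  - by move=> n; exists (- n%:R), n%:R, (- n%:R), n%:R.
  - exact: bigcup_rect.
  - by move=> B /frect[].
  - by move=> n; apply: (frect _ _).2; exists (- n%:R), n%:R, (- n%:R), n%:R.
have ae0 (g : plane -> \bar R) (A : set plane) : measurable A -> measurable_fun
  setT g ->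
    (forall x, (0 <= g x)%E) -> (\int[planeM]_(x in A) g x = 0)%E ->
    {ae planeM, forall p, A p -> g p = 0%E}.
  move=> mA mg g0 ig.
  have /ae_eq_integral_abs : (\int[planeM]_(x in A) `|g x| = 0)%E.
    by rewrite -[RHS]ig; apply: eq_integral => x _; rewrite gee0_abs.
  by apply=> //; exact: measurable_funTS.
pose P := [set p : plane | 0 < a p]; pose N := [set p : plane | a p < 0].
have mP : measurable P.
  by rewrite (_ : P = setT `&` a @^-1` `]0, +oo[); [exact: ma|
    rewrite setTI; apply/seteqP; split=> p; rewrite /= in_itv/= andbT].
have mN : measurable N.
  by rewrite (_ : N = setT `&` a @^-1` `]-oo, 0[); [exact: ma|
    rewrite setTI; apply/seteqP; split=> p; rewrite /= in_itv].
have aeP : {ae planeM, forall p, P p -> (f^\+ p = 0)%E}.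
  apply: ae0 => //; rewrite -[LHS]/(mup P) mE//.
  apply: integral0_eq => p /= ap; rewrite funenegE /f /=.
  by apply/max_idPr; rewrite lee_fin oppr_le0 ltW.
have aeN : {ae planeM, forall p, N p -> (f^\- p = 0)%E}.
  apply: ae0 => //; rewrite -[LHS]/(mun N) -mE//.
  apply: integral0_eq => p /= ap; rewrite funeposE /f /=.
  by apply/max_idPr; rewrite lee_fin ltW.
apply: filterS2 aeP aeN => p hP hN.
have [ap|ap|//] := ltgtP (a p) 0.
- have := hN ap; rewrite funenegE /f /= => h.
  have : ((- a p)%:E <= 0)%E by rewrite -h le_max lexx.
  by rewrite lee_fin oppr_le0 leNgt ap.
- have := hP ap; rewrite funeposE /f /= => h.
  have : ((a p)%:E <= 0)%E by rewrite -h le_max lexx.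
  by rewrite lee_fin leNgt ap.
Qed.

End rectangles.

(** * Weighted square-integrable solutions of the Cauchy-Riemann equations *)

Section liouville.
Context {R : realType}.
Local Notation plane := (measurableTypeR R * measurableTypeR R)%type.
Local Notation is_der x f a := (is_derive (x : R) (1 : R) (f : R -> R) (a : R)).
Implicit Types a b psi : R * R -> R.

(** A half-open interval [[x, x'[] neither gains nor loses a point under a small enough increase. *)
Lemma rect_right_continuous (x1 x2 y1 y2 : R) (w : R * R) : exists2 d, 0 < d &
  forall z : R * R, 0 < z.1 - w.1 < d -> 0 < z.2 - w.2 < d ->
    \1_(rect x1 x2 y1 y2) z = \1_(rect x1 x2 y1 y2) w :> R.
Proof.
have itv (x x' u : R) : exists2 d, 0 < d &
    forall v, 0 < v - u < d -> (x <= v < x') = (x <= u < x').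
  have [ux|xu] := ltP u x.
    exists (x - u); first by rewrite subr_gt0.
    by move=> v /andP[h1 h2]; rewrite leNgt (_ : v < x); last by lra.
  have [ux'|x'u] := ltP u x'.
    exists (x' - u); first by rewrite subr_gt0.
    by move=> v /andP[h1 h2]; apply/andP; split; lra.
  exists 1 => // v /andP[h1 h2]; rewrite andbF ltNge (_ : x' <= v) ?andbF//.
  by lra.
have [d1 d10 h1] := itv x1 x2 w.1; have [d2 d20 h2] := itv y1 y2 w.2.
exists (Num.min d1 d2); first by rewrite lt_min d10.
move=> z; rewrite !lt_min => /andP[z1 /andP[z2 z3]] /andP[z4 /andP[z5 z6]].
rewrite !indicE; congr (_ %:R); congr nat_of_bool; apply/idP/idP.
  by rewrite !inE => /rectP; rewrite h1 ?z1// h2 ?z4// => /rectP.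
by rewrite !inE => /rectP[? ?]; apply/rectP; rewrite h1 ?z1// h2 ?z4.
Qed.

Lemma conv_C2 e (D : nat -> R -> R) a : 0 < e <= 1 -> bump_family e D ->
  locint a ->
  C2 (conv a (bkernel D 0 0)) (conv a (bkernel D 1 0)) (conv a (bkernel D 2 0))
     (conv a (bkernel D 0 1)) (conv a (bkernel D 0 2)).
Proof.
move=> e01 DD ai; have B i j := bkernelP i j e01 DD.
have K i j : kernel (bkernel D i j) by have [] := B i j.
have c i j : continuous (conv a (bkernel D i j)).
  by have [? ? _ _] := B i j; exact: conv_continuous.
have dx i j x y : is_der x (fun t => conv a (bkernel D i j) (t, y))
    (conv a (bkernel D i.+1 j) (x, y)).
  by have [_ _ ? _] := B i j; exact: conv_dx.
have dy i j x y : is_der y (fun t => conv a (bkernel D i j) (x, t))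
    (conv a (bkernel D i j.+1) (x, y)).
  by have [_ _ _ ?] := B i j; exact: conv_dy.
by split.
Qed.

(** * Vanishing of weak solutions v = a + i b with |v|^2 e^psi integrable *)

Section weighted_L2.
Variables (a b psi px pxx py pyy : R * R -> R).
Hypothesis ai : locint a.
Hypothesis bi : locint b.
Hypothesis cpsi : C2 psi px pxx py pyy.
Hypothesis lap_psi : forall p, 0 <= pxx p + pyy p.
Hypothesis wi : integ (wnorm a b psi).
(** The weak equation dbar v = 0 tested on translated kernels: it says that the mollifications of v
    and their derivatives satisfy the Cauchy-Riemann equations. *)
Hypothesis CR : forall e D, 0 < e <= 1 -> bump_family e D -> forall i j z,
  conv a (bkernel D i.+1 j) z = conv b (bkernel D i j.+1) z /\
  conv a (bkernel D i j.+1) z = - conv b (bkernel D i.+1 j) z.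

Let ce : continuous (fun p => expR (psi p)).
Proof. by apply: cont_comp; [exact: cont_expR|exact: C2_cont cpsi]. Qed.

(** Allows the weight to be removed on compact sets, both for local integrability of |v|^2 and for
    the estimate on a rectangle. *)
Lemma weight_lower_bound (M : R) :
  exists2 c, 0 < c & forall p, box M p -> c <= expR (psi p).
Proof.
have [K K0 hK] := continuous_box_bounded M (C2_cont cpsi).
exists (expR (- K)); first exact: expR_gt0.
by move=> p /hK; rewrite ler_norml ler_expR => /andP[].
Qed.

Lemma locint_sqr (g : R * R -> R) : measurable_fun setT (g : plane -> R) ->
  (forall p, 0 <= g p <= a p ^+ 2 + b p ^+ 2) -> locint g.
Proof.
move=> mg hg; split=> // M; have [c c0 hc] := weight_lower_bound M.
apply: (integ_le (g := fun p => c^-1 * wnorm a b psi p)).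
- by apply: measurable_funM => //; exact: measurable_ibox.
- exact: integZ.
- move=> p; have /andP[g0 g1] := hg p.
  have n0 : 0 <= a p ^+ 2 + b p ^+ 2 by rewrite addr_ge0 ?sqr_ge0.
  have [pM|pM] := pselect (box M p); last first.
    rewrite /ibox indicE memNset// mulr0 normr0.
    by rewrite !mulr_ge0 ?expR_ge0 ?invr_ge0 ?(ltW c0).
  rewrite /ibox indicE mem_set// mulr1 ger0_norm// /wnorm mulrC ler_pdivlMr//.
  by rewrite ler_pM ?(ltW c0)// hc.
Qed.

Let nrm p := a p ^+ 2 + b p ^+ 2.

Let nrm_ge0 p : 0 <= nrm p. Proof. by rewrite addr_ge0 ?sqr_ge0. Qed.

Let locint_a2 : locint (fun p => a p ^+ 2).
Proof.
apply: locint_sqr => [|p]; first by apply: measurable_funX; exact: ai.1.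
by rewrite sqr_ge0 lerDl sqr_ge0.
Qed.

Let locint_b2 : locint (fun p => b p ^+ 2).
Proof.
apply: locint_sqr => [|p]; first by apply: measurable_funX; exact: bi.1.
by rewrite sqr_ge0 lerDr sqr_ge0.
Qed.

Let locint_nrm : locint nrm.
Proof. exact: locintD. Qed.

Definition tail (L : R) : R :=
  pint (fun p => wnorm a b psi p * \1_[set p : plane | L <= 3 * sqnorm2 p] p).

Lemma integ_tail L :
  integ (fun p => wnorm a b psi p * \1_[set p : plane | L <= 3 * sqnorm2 p] p).
Proof.
have mA : measurable [set p : plane | L <= 3 * sqnorm2 p].
  rewrite (_ : mkset _ = setT `&` (fun p : plane => 3 * sqnorm2 p) @^-1` `[L,
    +oo[).
    apply: (continuous_plane_measurable (F := fun p => 3 * sqnorm2 p)) => //.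
    by apply: contM; [exact: contC|exact: continuous_sqnorm2].
  by rewrite setTI; apply/seteqP; split=> p; rewrite /= in_itv/= andbT.
apply: (integ_le (g := fun p => `|wnorm a b psi p|)).
- apply: measurable_funM; first exact: integ_measurable wi.
  exact: measurable_indic.
- exact: integ_norm.
- move=> p; rewrite normrM ler_piMr// indicE.
  by case: (_ \in _); rewrite ?normr1 ?normr0.
Qed.

Lemma tail_cvg : tail n%:R @[n --> \oo] --> 0.
Proof.
have -> : 0 = pint (fun _ : R * R => 0 : R).
  by rewrite /pint /Rintegral integral0.
apply: fine_cvg; rewrite fineK; last by rewrite integral0.
apply: (@dominated_cvg _ _ _ planeM setT measurableT
  (fun n (p : plane) => (wnorm a b psi p *
     \1_[set p : plane | n%:R <= 3 * sqnorm2 p] p)%:E)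
  (fun _ => 0%E) (fun p : plane => `|wnorm a b psi p|%:E)) => //.
- by move=> n; apply/measurable_EFinP; exact: integ_measurable (integ_tail _).
- move=> p _; apply: cvg_EFin; first exact: nearW.
  apply: cvg_near_cst; near=> n.
  rewrite /= indicE memNset ?mulr0//= => h.
  have : 3 * sqnorm2 p < n%:R.
    by near: n; exact: nbhs_infty_gtr.
  by rewrite ltNge h.
- exact: integ_norm.
- move=> n p _; rewrite /= lee_fin normrM ler_piMr// indicE.
  by case: (_ \in _); rewrite ?normr1 ?normr0.
Unshelve. all: by end_near. Qed.

Lemma kappa2_le (L : R) p : 1 <= L ->
  kappa2 L p <= 2 * L ^+ 2 * \1_[set p : plane | L <= 3 * sqnorm2 p] p.
Proof.
move=> L1; rewrite /kappa2 indicE.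
have s0 : 0 <= sqnorm2 p by rewrite /sqnorm2 addr_ge0 ?sqr_ge0.
have [h|h] := leP L (3 * sqnorm2 p); last first.
  have [[? _]|[_ ->]] := posP (3 * sqnorm2 p - L); first by lra.
  by rewrite mulr0 mulr_ge0// mulr_ge0// sqr_ge0.
rewrite mem_set// mulr1; have [[? ->]|[_ ->]] := posP (L - sqnorm2 p); last first.
  by rewrite mul0r mulr_ge0// sqr_ge0.
have [[? ->]|[_ ->]] := posP (3 * sqnorm2 p - L); last first.
  by rewrite mulr0 mulr_ge0// sqr_ge0.
rewrite (_ : 2 * L ^+ 2 = L * (2 * L)); last by ring.
by rewrite ler_pM//; lra.
Qed.

(** The mollification is holomorphic, so the subharmonic estimate applies with the original weight.
    Jensen's inequality is used on the outer side only and leaves there an expression linear in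
    |v|^2. *)
Lemma mollified_kappa e D (L : R) : 0 < e <= 1 -> bump_family e D -> 1 <= L ->
  pint (fun p => wnorm (conv a (bkernel D 0 0)) (conv b (bkernel D 0 0)) psi p *
    kappa1 L p) <=
  pint (fun p => kappa2 L p * expR (psi p) * conv nrm (bkernel D 0 0) p).
Proof.
move=> e01 DD L1.
have ca := conv_C2 e01 DD ai; have cb := conv_C2 e01 DD bi.
have cS := wnorm_C2 ca cb cpsi.
have cr := CR e01 DD.
apply: (le_trans (subharmonic_kappa L1 cS _)).
  move=> p; apply: wnorm_subharmonic => //.
  - by have [] := cr 0 0 p.
  - by have [] := cr 0 0 p.
  (* Harmonicity: both second derivatives of one part equal, up to sign, the convolution of the
     other part with the kernel of index (1, 1). *)
  - by rewrite (cr 1 0 p).1 (cr 0 1 p).2 subrr.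
  - have := (cr 1 0 p).2; have := (cr 0 1 p).1 => -> ->.
    by rewrite subrr.
have [kk lk _ _] := bkernelP 0 0 e01 DD.
have cN := conv_continuous locint_nrm kk lk.
apply: le_pint.
- apply: (@off_box_integ _ L).
    by apply: contM; [exact: C2_cont cS|exact: continuous_kappa2].
  by move=> p /(off_box_kappa2 L1) ->; rewrite mulr0.
- apply: (@off_box_integ _ L).
    by apply: contM => //; apply: contM => //; exact: continuous_kappa2.
  by move=> p /(off_box_kappa2 L1) ->; rewrite !mul0r.
- move=> p; set k := kappa2 L p.
  rewrite (_ : wnorm _ _ _ p * k = k * expR (psi p) *
    (conv a (bkernel D 0 0) p ^+ 2 + conv b (bkernel D 0 0) p ^+ 2)); last first.
    by rewrite /wnorm; ring.
  rewrite ler_wpM2l//; first by rewrite mulr_ge0 ?expR_ge0//;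
    have [] := kappa_ge0 L p.
  have -> : conv nrm (bkernel D 0 0) p =
      conv (fun p => a p ^+ 2) (bkernel D 0 0) p +
      conv (fun p => b p ^+ 2) (bkernel D 0 0) p.
    rewrite /conv -pintD; [|exact: conv_integ..].
    by apply: eq_pint => w; rewrite mulrDl.
  apply: lerD; first exact: (@conv_jensen _ a e D p e01 DD ai locint_a2).
  exact: (@conv_jensen _ b e D p e01 DD bi locint_b2).
Qed.

Lemma rect_in_disc (x1 x2 y1 y2 : R) : exists L0, forall L, L0 <= L ->
  1 <= L /\ forall p, rect x1 x2 y1 y2 p -> box L p /\ 6 * sqnorm2 p <= L.
Proof.
pose M := `|x1| + `|x2| + `|y1| + `|y2|.
have M0 : 0 <= M by rewrite !addr_ge0.
(* Both coordinates are at most M on the rectangle, so 6 |p|^2 <= 12 M^2; the rest ensures L >= 1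
   and the inclusion in the box. *)
exists (1 + M + 12 * M ^+ 2) => L hL.
have M2 := sqr_ge0 M.
split; first by lra.
move=> p /rectP[/andP[h1 h2] /andP[h3 h4]].
have n1 := ler_norm x2; have n2 := ler_norm (- x1); rewrite normrN in n2.
have n3 := ler_norm y2; have n4 := ler_norm (- y1); rewrite normrN in n4.
have p1 := normr_ge0 x1; have p2 := normr_ge0 x2.
have p3 := normr_ge0 y1; have p4 := normr_ge0 y2.
have m1 : `|p.1| <= M by rewrite /M ler_norml; apply/andP; split; lra.
have m2 : `|p.2| <= M by rewrite /M ler_norml; apply/andP; split; lra.
split; first by apply/boxP; split; lra.
have q1 : p.1 ^+ 2 <= M ^+ 2 by rewrite -real_normK ?num_real// lerXn2r.
have q2 : p.2 ^+ 2 <= M ^+ 2 by rewrite -real_normK ?num_real// lerXn2r.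
by rewrite /sqnorm2; lra.
Qed.

Lemma kappa1_ge (L : R) p : 1 <= L -> 6 * sqnorm2 p <= L ->
  3^-1 * L ^+ 2 <= kappa1 L p.
Proof.
move=> L1 h; rewrite /kappa1.
have [[? ->]|[? ->]] := posP (L - sqnorm2 p); last by lra.
have [[? ->]|[? ->]] := posP (L - 3 * sqnorm2 p); last by lra.
(* The factors are at least 5 L / 6 and L / 2; lowering the first to 2 L / 3 gives the round
   constant 1 / 3. *)
rewrite (@le_trans _ _ ((2 / 3 * L) * (2^-1 * L)))//.
  by rewrite le_eqVlt; apply/orP; left; apply/eqP; field.
by rewrite ler_pM//; lra.
Qed.

Lemma integ_indic_rect (x1 x2 y1 y2 : R) : integ \1_(rect x1 x2 y1 y2).
Proof.
have [L0 /(_ L0 (lexx L0))[L1 hL]] := rect_in_disc x1 x2 y1 y2.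
apply: integ_le (integ_ibox L0) _.
  by apply: measurable_indic; exact: measurable_rect.
move=> p; rewrite /ibox !indicE; case: (boolP (p \in rect _ _ _ _)) => [|_].
  by rewrite inE => /hL[pM _]; rewrite mem_set// normr1.
by rewrite normr0.
Qed.

(* 2 t g <= t^2 + g^2 makes the quadratic estimate linear in g, so that it
   passes to the limit of the mollifications. *)
Lemma rect_integral_bound (g : R * R -> R) (x1 x2 y1 y2 : R) : locint g ->
  (forall e D p, 0 < e <= 1 -> bump_family e D -> conv g (bkernel D 0 0) p ^+ 2 <=
    conv a (bkernel D 0 0) p ^+ 2 + conv b (bkernel D 0 0) p ^+ 2) ->
  exists C L0 : R, forall L, L0 <= L -> forall t,
  2 * t * pint (fun p => g p * \1_(rect x1 x2 y1 y2) p) <=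
    t ^+ 2 * pint \1_(rect x1 x2 y1 y2) + C * tail L.
Proof.
move=> gi gab; set Q := rect x1 x2 y1 y2.
have [L0 hL0] := rect_in_disc x1 x2 y1 y2.
have [L01 hQ] := hL0 L0 (lexx L0).
(* The box of [L0] already contains the rectangle, so [c] does not depend on [L]. *)
have [c c0 hc] := weight_lower_bound L0.
(* On the rectangle the weight is at least [c] and [kappa1] at least L^2 / 3, which costs 3 / (c
   L^2); [kappa2_le] contributes 2 L^2, and the powers of L cancel. *)
exists (6 / c), L0 => L hL t.
have [L1 hQL] := hL0 L hL.
have DDe n := @bump_family_exists R n.+1%:R^-1 ltac:(by []).
have /choice[D DD] := DDe.
have e01 n : 0 < (n.+1%:R : R)^-1 <= 1.
  by rewrite invr_gt0 ltr0n/= invf_le1// ler1n.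
have mQ : measurable_fun setT (\1_Q : plane -> R).
  by apply: measurable_indic; exact: measurable_rect.
have QK z : `|\1_Q z : R| <= 1.
  by rewrite indicE; case: (_ \in _); rewrite ?normr1 ?normr0.
have Q0 z : ~ box L z -> \1_Q z = 0 :> R.
  by move=> zL; rewrite indicE memNset// => /hQL[].
have lim1 := @mollify_limit R g \1_Q L 1 D gi mQ QK Q0 _ DD.
have {}lim1 : pint (fun z => \1_Q z * conv g (bkernel (D n) 0 0) z) @[n --> \oo]
  -->
    pint (fun w => g w * \1_Q w).
  apply: lim1 => w e e0; have [d d0 hd] := rect_right_continuous x1 x2 y1 y2 w.
  by exists d => // z z1 z2; rewrite hd// subrr normr0 ltW.
pose chi p := kappa2 L p * expR (psi p).
have cchi : continuous chi by apply: contM => //; exact: continuous_kappa2.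
have ochi : off_box L chi by move=> p /(off_box_kappa2 L1); rewrite /chi => ->;
  rewrite mul0r.
have [K K0 hK] := continuous_box_bounded L cchi.
have chi0 z : ~ box L z -> chi z = 0.
  move=> zL; apply: ochi; apply/orP; rewrite -[_ || _]negbK negb_or.
  apply/negP => /andP[h1 h2]; apply: zL; apply/boxP.
  by split; rewrite ltW// ltNge.
have chiK z : `|chi z| <= K.
  have [/hK//|/chi0 ->] := pselect (box L z); by rewrite normr0 ltW.
have lim2 : pint (fun z => chi z * conv nrm (bkernel (D n) 0 0) z) @[n --> \oo]
  -->
    pint (fun w => nrm w * chi w).
  apply: (@mollify_limit R nrm chi L K) => //.
    exact: continuous_plane_measurable.
  move=> w e e0; have /cvgrPdist_le/(_ e e0) := cchi w.
  move=> /nbhs_ballP[d /= d0 hd]; exists d => // z /andP[z1 z2] /andP[z3 z4].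
  rewrite distrC; apply: hd; split; rewrite /ball/= distrC.
    by rewrite gtr0_norm.
  by rewrite gtr0_norm.
have i1 n : integ (fun p => \1_Q p * conv g (bkernel (D n) 0 0) p).
  have [kk lk _ _] := bkernelP 0 0 (e01 n) (DD n).
  have cg := conv_continuous gi kk lk.
  have [] // := @locint_mul _ _ \1_Q L 1 (locint_continuous cg) mQ QK Q0.
  by move=> + _; apply: eq_integ => p; rewrite mulrC.
have i2 n : integ (fun p => wnorm (conv a (bkernel (D n) 0 0))
    (conv b (bkernel (D n) 0 0)) psi p * kappa1 L p).
  have ca := conv_C2 (e01 n) (DD n) ai; have cb := conv_C2 (e01 n) (DD n) bi.
  apply: (@off_box_integ _ L).
    apply: contM; last exact: continuous_kappa1.
    exact: C2_cont (wnorm_C2 ca cb cpsi).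
  by move=> p /(off_box_kappa1 L1) ->; rewrite mulr0.
have Lge0 : 0 <= L by exact: le_trans L1.
have L20 : 0 < L ^+ 2 by rewrite exprn_gt0// (lt_le_trans _ L1).
have step n : 2 * t * pint (fun z => \1_Q z * conv g (bkernel (D n) 0 0) z) <=
    t ^+ 2 * pint \1_Q + 3 / (c * L ^+ 2) *
      pint (fun z => chi z * conv nrm (bkernel (D n) 0 0) z).
  apply: (@le_trans _ _ (t ^+ 2 * pint \1_Q + 3 / (c * L ^+ 2) *
    pint (fun p => wnorm (conv a (bkernel (D n) 0 0))
    (conv b (bkernel (D n) 0 0)) psi p * kappa1 L p))); last first.
    rewrite lerD2l ler_wpM2l//; first by rewrite divr_ge0// mulr_ge0 ?ltW.
    exact: (mollified_kappa (e01 n) (DD n) L1).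
  have iQ := integ_indic_rect x1 x2 y1 y2.
  rewrite -(pintZ _ (i1 n)) -(pintZ _ iQ) -(pintZ _ (i2 n)).
  rewrite -(pintD (integZ _ iQ) (integZ _ (i2 n))).
  apply: le_pint; [exact: integZ|by apply: integD; exact: integZ|].
  move=> p; pose A := conv a (bkernel (D n) 0 0) p.
  pose B := conv b (bkernel (D n) 0 0) p.
  set G := conv g (bkernel (D n) 0 0) p; rewrite -/Q.
  have GAB : G ^+ 2 <= A ^+ 2 + B ^+ 2 by exact: (gab _ (D n) p (e01 n) (DD n)).
  have [k1 _] := kappa_ge0 L p.
  have n0 : 0 <= A ^+ 2 + B ^+ 2 by rewrite addr_ge0 ?sqr_ge0.
  rewrite indicE; have [pQ|pQ] := boolP (p \in Q); last first.
    rewrite mul0r !mulr0 add0r mulr_ge0//.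
      by rewrite divr_ge0// mulr_ge0 ?ltW.
    by rewrite mulr_ge0// mulr_ge0 ?expR_ge0.
  rewrite mul1r mulr1.
  have cp : c <= expR (psi p) by apply: hc; rewrite inE in pQ; exact: (hQ p pQ).1.
  have kp : 3^-1 * L ^+ 2 <= kappa1 L p.
    by apply: kappa1_ge => //; rewrite inE in pQ; exact: (hQL p pQ).2.
  have : A ^+ 2 + B ^+ 2 <= 3 / (c * L ^+ 2) * (wnorm (conv a (bkernel (D n) 0 0))
      (conv b (bkernel (D n) 0 0)) psi p * kappa1 L p).
    have -> : A ^+ 2 + B ^+ 2 = 3 / (c * L ^+ 2) *
        ((A ^+ 2 + B ^+ 2) * c * (3^-1 * L ^+ 2)).
      by field; rewrite !gt_eqF// (lt_le_trans _ L1).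
    rewrite ler_wpM2l//; first by rewrite divr_ge0// mulr_ge0 ?ltW.
    rewrite /wnorm -/A -/B ler_pM// ?mulr_ge0 ?invr_ge0 ?(ltW c0) ?(ltW L20)//.
    by rewrite ler_wpM2l.
  have : 0 <= (t - G) ^+ 2 by exact: sqr_ge0.
  rewrite sqrrB => h1 h2.
  have -> : 2 * t * G = t * G *+ 2 by rewrite mulr2n; ring.
  lra.
have : 2 * t * pint (fun p => g p * \1_Q p) <= t ^+ 2 * pint \1_Q +
    3 / (c * L ^+ 2) * pint (fun w => nrm w * chi w).
  have l1 : 2 * t * pint (fun z => \1_Q z * conv g (bkernel (D n) 0 0) z)
      @[n --> \oo] --> 2 * t * pint (fun p => g p * \1_Q p).
    by apply: cvgM; [exact: cvg_cst|exact: lim1].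
  have l2 : t ^+ 2 * pint \1_Q + 3 / (c * L ^+ 2) *
      pint (fun z => chi z * conv nrm (bkernel (D n) 0 0) z) @[n --> \oo] -->
      t ^+ 2 * pint \1_Q + 3 / (c * L ^+ 2) * pint (fun w => nrm w * chi w).
    by apply: cvgD; [exact: cvg_cst|apply: cvgM; [exact: cvg_cst|exact: lim2]].
  by apply: (ler_cvg_to l1 l2); near=> n; exact: step.
move=> h; apply: (le_trans h); rewrite lerD2l.
have [i3 _] := locint_mul locint_nrm (continuous_plane_measurable cchi) chiK chi0.
apply: (@le_trans _ _ (3 / (c * L ^+ 2) * (2 * L ^+ 2 * tail L))).
  rewrite ler_wpM2l//; first by rewrite divr_ge0// mulr_ge0 ?ltW.
  rewrite -(pintZ _ (integ_tail L)); apply: le_pint => //.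
    exact/integZ/integ_tail.
  move=> p; rewrite /chi /wnorm -/(nrm p).
  rewrite (_ : nrm p * _ = nrm p * expR (psi p) * kappa2 L p); last by ring.
  rewrite [leRHS]mulrCA ler_wpM2l//; first by rewrite mulr_ge0 ?expR_ge0.
  exact: kappa2_le.
rewrite le_eqVlt; apply/orP; left; apply/eqP; field.
by rewrite !gt_eqF// (lt_le_trans _ L1).
Unshelve. all: by end_near. Qed.

Lemma rect_integral0 (g : R * R -> R) (x1 x2 y1 y2 : R) : locint g ->
  (forall e D p, 0 < e <= 1 -> bump_family e D -> conv g (bkernel D 0 0) p ^+ 2 <=
    conv a (bkernel D 0 0) p ^+ 2 + conv b (bkernel D 0 0) p ^+ 2) ->
  pint (fun p => g p * \1_(rect x1 x2 y1 y2) p) = 0.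
Proof.
move=> gi gab; have [C [L0 h]] := rect_integral_bound x1 x2 y1 y2 gi gab.
set I := pint _ in h *; set q := pint _ in h.
have q0 : 0 <= q by apply: pint_ge0 => p.
have {}h t : 2 * t * I <= t ^+ 2 * q.
  have lim : t ^+ 2 * q + C * tail n%:R @[n --> \oo] --> t ^+ 2 * q + C * 0.
    apply: cvgD; first exact: cvg_cst.
    by apply: cvgM; [exact: cvg_cst|exact: tail_cvg].
  rewrite mulr0 addr0 in lim.
  apply: (ler_cvg_to (cvg_cst (2 * t * I)) lim).
  near=> n; apply: h; apply: ltW; near: n; exact: nbhs_infty_gtr.
(* The optimal t would be I / q; the shift by 1 covers q = 0 and still leaves I^2 (q + 2) / (q +
   1)^2 <= 0. *)
have := h (I / (q + 1)).
have q1 : 0 < q + 1 by rewrite ltr_wpDl.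
rewrite -subr_ge0 (_ : _ - _ = - (I ^+ 2 * (q + 2) / (q + 1) ^+ 2)); last first.
  by field; rewrite gt_eqF.
rewrite oppr_ge0 pmulr_lle0 ?invr_gt0 ?exprn_gt0// pmulr_lle0; last by lra.
by move=> I0; apply/eqP; rewrite -sqrf_eq0; apply/eqP/le_anti; rewrite I0 sqr_ge0.
Unshelve. all: by end_near. Qed.

Lemma weighted_L2_ae0 : {ae planeM, forall p : plane, a p = 0} /\
  {ae planeM, forall p : plane, b p = 0}.
Proof.
split; apply: rect_integral0_ae => // x1 x2 y1 y2; apply: rect_integral0 => //.
  by move=> e D p _ _; rewrite lerDl sqr_ge0.
by move=> e D p _ _; rewrite lerDr sqr_ge0.
Qed.

End weighted_L2.
End liouville.

(** * Functions of a complex variable *)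

Section transfer.
Context {R : realType}.
Local Notation C := (Cplx R).
Local Notation plane := (measurableTypeR R * measurableTypeR R)%type.
Local Notation is_der x f a := (is_derive (x : R) (1 : R) (f : R -> R) (a : R)).
Implicit Types (h : C -> R) (u f : C -> C).

Lemma Ck_toC_C2 h : Ck 2 h ->
  C2 (fun p => h (toC p)) (fun p => dx h (toC p)) (fun p => dx (dx h) (toC p))
     (fun p => dy h (toC p)) (fun p => dy (dy h) (toC p)).
Proof.
move=> [ch [hx hy [chx [hxx _ [cxx _] _]] [chy [_ hyy _ [cyy _]]]]].
have ct (g : C -> R) : continuous g -> continuous (fun p => g (toC p)).
  move=> cg p; apply: (continuous_comp (f := @toC R));
    first exact: continuous_toC.
  exact: cg.
split; try exact: ct.
- by move=> x y; exact: derivable_der (hx (toC (x, y))).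
- by move=> x y; exact: derivable_der (hxx (toC (x, y))).
- by move=> x y; exact: derivable_der (hy (toC (x, y))).
- by move=> x y; exact: derivable_der (hyy (toC (x, y))).
Qed.

Lemma C2_lap h hx hxx hy hyy : C2 (fun p => h (toC p)) hx hxx hy hyy ->
  forall p, lap h (toC p) = 4^-1 * (hxx p + hyy p).
Proof.
move=> c2 [x y].
have dxE : dx h = (fun z => hx (re z, im z)).
  by apply/funext => z; exact: der_derive1 (C2_dx c2 (re z) (im z)).
have dyE : dy h = (fun z => hy (re z, im z)).
  by apply/funext => z; exact: der_derive1 (C2_dy c2 (re z) (im z)).
rewrite /lap dxE dyE; congr (_ * (_ + _)).
  exact: der_derive1 (C2_dxx c2 x y).
exact: der_derive1 (C2_dyy c2 x y).
Qed.

Lemma C2_lin (k l : R) (F Fx Fxx Fy Fyy G Gx Gxx Gy Gyy : R * R -> R) :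
  C2 F Fx Fxx Fy Fyy -> C2 G Gx Gxx Gy Gyy ->
  C2 (fun p => k * F p + l * G p) (fun p => k * Fx p + l * Gx p)
     (fun p => k * Fxx p + l * Gxx p) (fun p => k * Fy p + l * Gy p)
     (fun p => k * Fyy p + l * Gyy p).
Proof.
case=> cF cFx cFxx cFy cFyy dF dFx dFy dFyy.
case=> cG cGx cGxx cGy cGyy dG dGx dGy dGyy.
have c (A B : R * R -> R) : continuous A -> continuous B ->
    continuous (fun p => k * A p + l * B p).
  by move=> cA cB; apply: contD; apply: contM => //; exact: contC.
split; try exact: c.
- by move=> x y; apply: derD; apply: derZ.
- by move=> x y; apply: derD; apply: derZ.
- by move=> x y; apply: derD; apply: derZ.
- by move=> x y; apply: derD; apply: derZ.
Qed.

Lemma C2_ln (F Fx Fxx Fy Fyy : R * R -> R) : C2 F Fx Fxx Fy Fyy ->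
  (forall p, 0 < F p) ->
  C2 (fun p => ln (F p)) (fun p => Fx p / F p)
     (fun p => Fxx p / F p - Fx p ^+ 2 / F p ^+ 2) (fun p => Fy p / F p)
     (fun p => Fyy p / F p - Fy p ^+ 2 / F p ^+ 2).
Proof.
case=> cF cFx cFxx cFy cFyy dF dFx dFy dFyy F0.
have Fn0 p : F p != 0 by rewrite gt_eqF.
have cV (A : R * R -> R) n : continuous A -> continuous (fun p => A p / F p ^+ n).
  move=> cA; apply: contM => // p; apply: cvgV; last exact: contX.
  by rewrite expf_neq0.
have cV1 (A : R * R -> R) : continuous A -> continuous (fun p => A p / F p).
  exact: (cV A 1%N).
split.
- move=> p; apply: continuous_comp; first exact: cF.
  exact: continuous_ln.
- exact: cV1.
- by apply: contB; [exact: cV1|apply: cV; exact: contX].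
- exact: cV1.
- by apply: contB; [exact: cV1|apply: cV; exact: contX].
- by move=> x y; exact: der_ln (dF x y) (F0 _).
- move=> x y; apply: is_derive_eq (derM (dFx x y) (derV (dF x y) (Fn0 _))) _.
  by field.
- by move=> x y; exact: der_ln (dFy x y) (F0 _).
- move=> x y; apply: is_derive_eq (derM (dFyy x y) (derV (dFy x y) (Fn0 _))) _.
  by field.
Qed.

Lemma C2_eq (F G Fx Fxx Fy Fyy : R * R -> R) : C2 F Fx Fxx Fy Fyy ->
  (forall p, F p = G p) -> C2 G Fx Fxx Fy Fyy.
Proof. by move=> cF /funext <-. Qed.

(** Multiplied by Delta phi > 0, the curvature condition reads Delta log Delta phi + 2 Delta phi >=
    0, and the left side is Delta psi. Four derivatives of [phi] make Delta phi, hence its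
    logarithm, twice differentiable. *)
Lemma log_weight_C2 (phi : C -> R) : Ck 4 phi -> (forall z, 0 < lap phi z) ->
  (forall z, (lap phi z)^-1 * lap (fun w => ln (lap phi w)) z >= - 2) ->
  exists px pxx py pyy,
    C2 (fun p => 2 * phi (toC p) + ln (lap phi (toC p))) px pxx py pyy /\
    forall p, 0 <= pxx p + pyy p.
Proof.
move=> [cphi [phx phy [cx [pxx_ pxy_ cxx cxy]] [cy [pyx_ pyy_ cyx cyy]]]] lap0
  curv.
have c2 : Ck 2 phi.
  case: cxx => cxx0 _; case: cyy => cyy0 _; case: cxy => cxy0 _;
    case: cyx => cyx0 _.
  by split=> //; split=> //; split.
have cphi2 := Ck_toC_C2 c2.
have lapE p : lap phi (toC p) =
    4^-1 * dx (dx phi) (toC p) + 4^-1 * dy (dy phi) (toC p)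
      by rewrite /lap mulrDr.
have cH := C2_eq (C2_lin 4^-1 4^-1 (Ck_toC_C2 cxx) (Ck_toC_C2 cyy)) (fsym lapE).
have [Lx [Lxx [Ly [Lyy cL]]]] : exists Lx Lxx Ly Lyy,
    C2 (fun p => ln (lap phi (toC p))) Lx Lxx Ly Lyy.
  by do 4 eexists; exact: (C2_ln cH (fun p => lap0 (toC p))).
have cP := C2_lin 2 1 cphi2 cL.
do 4 eexists; split.
  by apply: (C2_eq cP) => p; rewrite mul1r.
move=> p /=; rewrite !mul1r.
have := curv (toC p); rewrite (C2_lap (h := fun w => ln (lap phi w)) cL).
rewrite mulrC ler_pdivlMr// lapE.
move: (dx (dx phi) (toC p)) (dy (dy phi) (toC p)) (Lxx p) (Lyy p) => A B X Y.
lra.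
Qed.

End transfer.

(** * From the distributional equation to Cauchy-Riemann equations for mollifications *)

Section weak_dbar.
Context {R : realType}.
Local Notation C := (Cplx R).
Local Notation plane := (measurableTypeR R * measurableTypeR R)%type.
Local Notation is_der x f a := (is_derive (x : R) (1 : R) (f : R -> R) (a : R)).
Implicit Types (h : C -> R) (u f : C -> C) (D : nat -> R -> R).

Definition repart u (p : R * R) : R := re (u (toC p)).
Definition impart u (p : R * R) : R := im (u (toC p)).

Lemma L1loc_locint u : L1loc u -> locint (repart u) /\ locint (impart u).
Proof.
move=> [[mre mim] hK].
have mmod : measurable_fun setT (fun p : plane => modulus (u (toC p))).
  have -> : (fun p : plane => modulus (u (toC p))) =
      (fun p => Num.sqrt (repart u p ^+ 2 + impart u p ^+ 2)).
    by apply/funext => p; rewrite /repart /impart; case: (u (toC p)).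
  apply: measurableT_comp.
    by apply: continuous_measurable_fun; exact: sqrt_continuous.
  by apply: measurable_funD; apply: measurable_funX.
have key (g : R * R -> R) : measurable_fun setT (g : plane -> R) ->
    (forall p, `|g p| <= modulus (u (toC p))) -> locint g.
  move=> mg hg; split=> // M; apply/integrableP; split.
    by apply/measurable_EFinP; apply: measurable_funM => //;
      exact: measurable_ibox.
  have := hK _ (@compact_Cbox R M); rewrite preimage_Cbox; apply: le_lt_trans.
  rewrite [leRHS]integral_mkcond; apply: ge0_le_integral => //=.
  - by apply/measurable_EFinP; apply: measurableT_comp => //;
      apply: measurable_funM => //; exact: measurable_ibox.
  - apply/(measurable_restrictT _ _).1; first exact: measurable_box.
    by apply/measurable_EFinP; exact: measurable_funTS.
  - move=> p _; rewrite patchE /ibox indicE; case: (p \in _).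
      by rewrite mulr1 lee_fin.
    by rewrite mulr0 normr0.
split; apply: key => // p; rewrite /repart /impart.
  by have [] := normc_bounds (u (toC p)).
by have [] := normc_bounds (u (toC p)).
Qed.

Section test.
Variables (e : R) (D : nat -> R -> R) (x y : R).
Hypothesis e01 : 0 < e <= 1.
Hypothesis DD : bump_family e D.

(** The scalar [c] absorbs the sign that each derivative in [w] produces, so the family is closed
    under [dx] and [dy]; c = 0 gives the vanishing imaginary part of [ctest]. *)
Definition ktest i j (c : R) (w : C) : R := c * (D i (x - re w) * D j (y - im w)).

Let dsub (t s : R) : is_der s (fun r => t - r) (- 1).
Proof. by apply: (is_derive_eq (derB (derC t s) (der_id s))); rewrite sub0r. Qed.

Let dD n t : is_der t (D n) (D n.+1 t).
Proof. by case: DD. Qed.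

Let der_x i j c (w : C) (s : R) : is_der s (slice_x (ktest i j c) w)
  (- c * (D i.+1 (x - s) * D j (y - im w))).
Proof.
apply: (is_derive_eq (derZ c (derM (der_comp (dsub x s) (dD i (x - s)))
  (derC (D j (y - im w)) s)))).
by rewrite mulr0 addr0 mulrN1 !mulNr mulrN.
Qed.

Let der_y i j c (w : C) (s : R) : is_der s (slice_y (ktest i j c) w)
  (- c * (D i (x - re w) * D j.+1 (y - s))).
Proof.
apply: (is_derive_eq (derZ c (derM (derC (D i (x - re w)) s)
  (der_comp (dsub y s) (dD j (y - s)))))).
by rewrite mul0r add0r mulrN1 !mulrN mulNr.
Qed.

Lemma dx_ktest i j c : dx (ktest i j c) = ktest i.+1 j (- c).
Proof. by apply/funext => w; exact: der_derive1 (der_x i j c w (re w)). Qed.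

Lemma dy_ktest i j c : dy (ktest i j c) = ktest i j.+1 (- c).
Proof. by apply/funext => w; exact: der_derive1 (der_y i j c w (im w)). Qed.

Lemma continuous_ktest i j c : continuous (ktest i j c).
Proof.
have cc n (t : R) (F : C -> R) : continuous F -> continuous (fun w => D n (t - F
  w)).
  move=> cF w; apply: (continuous_comp (f := F) (g := fun s => D n (t - s))).
    exact: cF.
  exact: der_continuous (der_comp (dsub t (F w)) (dD n (t - F w))).
have cM (F G : C -> R) : continuous F -> continuous G -> continuous (fun w => F
  w * G w).
  by move=> cF cG w; exact: (cvgM (cF w) (cG w)).
apply: (cM (fun=> c) (fun w => D i (x - re w) * D j (y - im w))).
  exact: cst_continuous.
by apply: cM; apply: cc; [exact: continuous_re|exact: continuous_im].
Qed.

Lemma Ck_ktest n i j c : Ck n (ktest i j c).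
Proof.
elim: n i j c => [|n IH] i j c; split=> //; try exact: continuous_ktest.
split.
- by move=> w; exact: der_derivable (der_x i j c w (re w)).
- by move=> w; exact: der_derivable (der_y i j c w (im w)).
- by rewrite dx_ktest.
- by rewrite dy_ktest.
Qed.

(** With a real test function, the real and imaginary parts of the weak equation are the two
    Cauchy-Riemann equations. *)
Definition ctest i j (w : C) : C := toC (ktest i j 1 w, 0).

Let im_ctest i j : im \o ctest i j = ktest i j 0.
Proof. by apply/funext => w; rewrite /ktest mul0r. Qed.

Lemma ctest_test_function i j : test_function (ctest i j).
Proof.
split=> [n|n|]; first exact: Ck_ktest.
  by rewrite im_ctest; exact: Ck_ktest.
pose M := `|x| + `|y| + 1.
apply: (subclosed_compact (B := Cbox M));
  [exact: closed_closure|exact: compact_Cbox|].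
rewrite (_ : Cbox M = closure (Cbox M)); last first.
  apply/closure_id; apply: compact_closed; last exact: compact_Cbox.
  exact: norm_hausdorff.
apply: closureS => w /= hw; have [_ D0 _ _] := DD.
have [e0 e1] := andP e01.
have n1 := normr_ge0 x; have n2 := normr_ge0 y.
have [/andP[h1 h2]|/D0 h] := boolP (0 < x - re w < e); last first.
  by move: hw; rewrite /ctest /ktest h mul0r mulr0 eqxx.
have [/andP[h3 h4]|/D0 h] := boolP (0 < y - im w < e); last first.
  by move: hw; rewrite /ctest /ktest h !mulr0 eqxx.
have near_center (t r m : R) : 0 < t - r -> t - r < e -> `|t| + 1 <= m -> `|r|
  <= m.
  move=> r1 r2 tm; rewrite (_ : r = t - (t - r)); last by ring.
  rewrite (le_trans (ler_normB _ _))// (gtr0_norm r1); apply: le_trans tm.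
  by rewrite lerD2l ltW// (lt_le_trans r2).
by split; [apply: near_center h1 h2 _|apply: near_center h3 h4 _]; rewrite /M;
  lra.
Qed.

Lemma dbar_ctest i j w : dbar (ctest i j) w =
  toC (2^-1 * ktest i.+1 j (- 1) w, 2^-1 * ktest i j.+1 (- 1) w).
Proof.
rewrite /dbar /dxC /dyC im_ctest dx_ktest dy_ktest.
rewrite (_ : re \o ctest i j = ktest i j 1)// dx_ktest dy_ktest oppr0.
rewrite (_ : (2^-1 : C) = toC (2^-1, 0)); last first.
  have -> : (2 : C) = ((2 : R)%:C)%C by rewrite rmorph_nat.
  by rewrite -fmorphV.
rewrite /ktest !mul0r.
set X := -1 * _; set Y := -1 * _.
have mulE (a b c d : R) : toC (a, b) * toC (c, d) =
  toC (a * c - b * d, a * d + b * c) :> C by [].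
have addE (a b c d : R) : toC (a, b) + toC (c, d) = toC (a + c, b + d) :> C by [].
by rewrite (mulE 0 1) addE (mulE 2^-1) !(mul0r, mulr0, mul1r, subr0, addr0,
  add0r, sub0r).
Qed.

Lemma ktestE i j (p : R * R) : ktest i j (- 1) (toC p) = - bkernel D i j ((x, y)
  - p).
Proof. by rewrite /ktest mulN1r. Qed.

(** The test function is a reflected translate of a kernel, so pairing with it is a convolution
    evaluated at (x, y). The factor - 1 / 2 joins the 1 / 2 of [dbar] to the sign of the
    reflection. *)
Lemma integral_dbar_ctest u i j : L1loc u ->
  integralC (fun w => u w * dbar (ctest i j) w) =
  toC (- 2^-1 * (conv (repart u) (bkernel D i.+1 j) (x, y) -
                 conv (impart u) (bkernel D i j.+1) (x, y)),
       - 2^-1 * (conv (repart u) (bkernel D i j.+1) (x, y) +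
                 conv (impart u) (bkernel D i.+1 j) (x, y))).
Proof.
move=> /L1loc_locint[ai bi].
have K k l : kernel (bkernel D k l) by have [] := bkernelP k l e01 DD.
have i1 := conv_integ (x, y) ai (K i.+1 j);
  have i2 := conv_integ (x, y) ai (K i j.+1).
have i3 := conv_integ (x, y) bi (K i.+1 j);
  have i4 := conv_integ (x, y) bi (K i j.+1).
have mulE (z : C) (c d : R) : z * toC (c, d) =
  toC (re z * c - im z * d, re z * d + im z * c) :> C by case: z.
rewrite /integralC; congr (toC (_, _)).
  rewrite /conv -(pintB i1 i4) -pintZ; last exact: integB.
  apply: eq_pint => p; rewrite dbar_ctest mulE re_toC /= !ktestE /repart /impart.
  by ring.
rewrite /conv -(pintD i2 i3) -pintZ; last exact: integD.
apply: eq_pint => p; rewrite dbar_ctest mulE im_toC /= !ktestE /repart /impart.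
by ring.
Qed.

End test.

(** Both pairings with dbar of a test function equal the same integral against [f], so they cancel
    in the difference. *)
Lemma weak_cauchy_riemann u1 u2 f : dbar_distr u1 f -> dbar_distr u2 f ->
  forall e D, 0 < e <= 1 -> bump_family e D -> forall i j z,
  conv (fun p => repart u1 p - repart u2 p) (bkernel D i.+1 j) z =
  conv (fun p => impart u1 p - impart u2 p) (bkernel D i j.+1) z /\
  conv (fun p => repart u1 p - repart u2 p) (bkernel D i j.+1) z =
  - conv (fun p => impart u1 p - impart u2 p) (bkernel D i.+1 j) z.
Proof.
move=> [l1 _ d1] [l2 _ d2] e D e01 DD i j [x y].
have K k l : kernel (bkernel D k l) by have [] := bkernelP k l e01 DD.
have [a1 b1] := L1loc_locint l1; have [a2 b2] := L1loc_locint l2.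
have convB (g1 g2 : R * R -> R) k : locint g1 -> locint g2 -> kernel k ->
    conv (fun p => g1 p - g2 p) k (x, y) = conv g1 k (x, y) - conv g2 k (x, y).
  move=> g1i g2i kk; rewrite /conv -pintB; [|exact: conv_integ..].
  by apply: eq_pint => w; rewrite mulrBl.
have tt := ctest_test_function x y e01 DD i j.
have : integralC (fun w => u1 w * dbar (ctest D x y i j) w) =
       integralC (fun w => u2 w * dbar (ctest D x y i j) w) by rewrite d1// d2.
rewrite !(integral_dbar_ctest x y e01 DD)// => -[h1 h2].
by rewrite !convB//; split; lra.
Qed.

End weak_dbar.

(** * The difference of two solutions *)

Section difference.
Context {R : realType}.
Local Notation C := (Cplx R).
Local Notation plane := (measurableTypeR R * measurableTypeR R)%type.

Lemma sqnorm_integ (w : C -> R) (u : C -> C) : continuous w ->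
  (forall z, 0 <= w z) -> measurable_cfun u -> (sqnorm w u < +oo)%E ->
  integ (fun p => (repart u p ^+ 2 + impart u p ^+ 2) * w (toC p)).
Proof.
move=> cw w0 [mre mim] fin; apply/integrableP; split.
  apply/measurable_EFinP; apply: measurable_funM.
    by apply: measurable_funD; apply: measurable_funX.
  apply: (continuous_plane_measurable (F := fun p => w (toC p))) => p.
  by apply: (continuous_comp (f := @toC R)); [exact: continuous_toC|exact: cw].
apply: le_lt_trans fin; rewrite le_eqVlt; apply/orP; left; apply/eqP.
apply: eq_integral => p _; rewrite /= ger0_norm ?sqr_modulus//.
by rewrite mulr_ge0// addr_ge0// sqr_ge0.
Qed.

Lemma continuous_log_weight (phi : C -> R) : Ck 4 phi ->
  continuous (fun z => expR (2 * phi z) * lap phi z).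
Proof.
move=> [cphi [_ _ [_ [_ _ [cxx _] _]] [_ [_ _ _ [cyy _]]]]].
have cM (F G : C -> R) : continuous F -> continuous G -> continuous (fun w => F
  w * G w).
  by move=> cF cG w; exact: (cvgM (cF w) (cG w)).
apply: (cM (fun z => expR (2 * phi z)) (lap phi)).
  move=> z; apply: (continuous_comp (f := fun z => 2 * phi z));
    last exact: continuous_expR.
  by apply: (cM (fun=> 2) phi); [exact: cst_continuous|exact: cphi].
apply: (cM (fun=> 4^-1) (fun z => dx (dx phi) z + dy (dy phi) z)).
  exact: cst_continuous.
by move=> z; exact: (cvgD (cxx z) (cyy z)).
Qed.

End difference.

Unset Implicit Arguments.

Theorem theorem1p4 (R : realType) (phi : Cplx R -> R) (f : Cplx R -> Cplx R)
  (phi_C4 : Ck 4 phi)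
  (lap_phi_gt0 : forall z, 0 < lap phi z)
  (curvature : forall z,
     (lap phi z)^-1 * lap (fun w => ln (lap phi w)) z >= - 2)
  (f_L2 : L2 (fun z => expR (2 * phi z)) f)
  (f_orth : forall g, A2 (fun z => expR (- 2 * phi z)) g ->
     integralC (fun z => f z * g z) = 0)
  (u1 u2 : Cplx R -> Cplx R)
  (dbar_u1 : dbar_distr u1 f)
  (u1_estimate : (sqnorm (fun z => (expR (2 * phi z) * lap phi z)%R) u1
     <= (2^-1)%:E * sqnorm (fun z => expR (2 * phi z)%R) f)%E)
  (dbar_u2 : dbar_distr u2 f)
  (u2_estimate : (sqnorm (fun z => (expR (2 * phi z) * lap phi z)%R) u2
     <= (2^-1)%:E * sqnorm (fun z => expR (2 * phi z)%R) f)%E) :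
  ae_eqC u1 u2.
Proof.
have [_ f_fin] := f_L2.
have [l1 _ _] := dbar_u1; have [l2 _ _] := dbar_u2.
have [a1 b1] := L1loc_locint l1; have [a2 b2] := L1loc_locint l2.
pose w z := expR (2 * phi z) * lap phi z.
have w0 z : 0 <= w z by rewrite mulr_ge0 ?expR_ge0// ltW.
have cw : continuous w by exact: continuous_log_weight.
have bound : ((2^-1)%:E * sqnorm (fun z => expR (2 * phi z)%R) f < +oo)%E.
  by rewrite lte_mul_pinfty.
have i1 := sqnorm_integ cw w0 l1.1 (le_lt_trans u1_estimate bound).
have i2 := sqnorm_integ cw w0 l2.1 (le_lt_trans u2_estimate bound).
have [px [pxx [py [pyy [cpsi lap_psi]]]]] := log_weight_C2 phi_C4 lap_phi_gt0
  curvature.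
set psi := (fun p => _) in cpsi.
have wE p : expR (psi p) = w (toC p) by rewrite /psi expRD lnK ?posrE.
have wi : integ (wnorm (fun p => repart u1 p - repart u2 p)
    (fun p => impart u1 p - impart u2 p) psi).
  (* Parallelogram law: 2 |u1|^2 + 2 |u2|^2 - |u1 - u2|^2 = |u1 + u2|^2 >= 0. *)
  apply: integ_le (integZ 2 (integD i1 i2)) _.
    apply: measurable_funM.
      apply: measurable_funD; apply: measurable_funX; apply: measurable_funB.
      - exact: a1.1.
      - exact: a2.1.
      - exact: b1.1.
      - exact: b2.1.
    apply: continuous_plane_measurable; apply: cont_comp; first exact: cont_expR.
    exact: C2_cont cpsi.
  move=> p; rewrite /wnorm wE ger0_norm; last first.
    by rewrite mulr_ge0// addr_ge0// sqr_ge0.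
  rewrite -mulrDl mulrA ler_wpM2r// -subr_ge0.
  rewrite (_ : _ - _ = (repart u1 p + repart u2 p) ^+ 2 +
    (impart u1 p + impart u2 p) ^+ 2); last by ring.
  by rewrite addr_ge0// sqr_ge0.
have [re0 im0] := weighted_L2_ae0 (locintB a1 a2) (locintB b1 b2) cpsi lap_psi wi
  (weak_cauchy_riemann dbar_u1 dbar_u2).
apply: filterS2 re0 im0 => p /eqP + /eqP; rewrite !subr_eq0 => /eqP h1 /eqP h2.
by rewrite -(toC_re_im (u1 (toC p))) -(toC_re_im (u2 (toC p)));
  congr (toC (_, _)).
Qed.
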